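(* Let $K$ be a field and let $X$ be a connected poset such that every derivation from $FI(X,K)$ to $I(X,K)$ is inner and every multiplicative automorphism of $FI(X,K)$ is inner (in particular, this covers the case when $X$ has an element that is comparable with all its elements). If $\Phi$ is an anti-automorphism (respectively, an involution) of $D(X,K)$, then $\Phi=\Psi\circ\widetilde{\rho_\lambda}\circ\widetilde{k\delta}$, where $\Psi$ is an inner automorphism of $D(X,K)$, $\lambda$ is the anti-automorphism (respectively, involution) of $X$ induced by $\Phi$, and $k\in K^*$. Moreover, when $\Phi$ is an involution, $k=\pm1$.
   Context: For a field $K$ and a poset $X$, the incidence space $I(X,K)$ is the $K$-space of functions $f:X\times X\to K$ with $f(x,y)=0$ whenever $x\nleq y$. The finitary incidence algebra $FI(X,K)$ is the subspace of all $f\in I(X,K)$ such that for all $x\le y$ in $X$ there are only finitely many subintervals $[u,v]\subseteq[x,y]$ with $u\ne v$ and $f(u,v)\neq 0$. It is an associative unital $K$-algebra, with unity $\delta$, under convolution $(fg)(x,y)=\sum_{x\le z\le y}f(x,z)g(z,y)$, and the same formula makes $I(X,K)$ an $FI(X,K)$-bimodule. $D(X,K)$ is the $K$-algebra $FI(X,K)\oplus I(X,K)$, elements written as columns, with multiplication $\begin{bmatrix}f\\ i\end{bmatrix}\begin{bmatrix}g\\ j\end{bmatrix}=\begin{bmatrix}fg\\ fj+ig\end{bmatrix}$. (Anti-)automorphisms of algebras are $K$-linear; inner automorphisms are the maps $a\mapsto uau^{-1}$, $u$ a unit; an anti-automorphism of a poset $X$ is a bijection $\lambda$ with $x\le y\Leftrightarrow\lambda(y)\le\lambda(x)$;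 an involution (on an algebra or poset) is an anti-automorphism whose square is the identity. A poset is connected if any two elements are joined by a finite sequence in which consecutive elements are comparable. A multiplicative automorphism of $FI(X,K)$ is a map $M_\sigma(f)(x,y)=\sigma(x,y)f(x,y)$, where $\sigma\in I(X,K)$ satisfies $\sigma(x,y)\neq0$ for all $x\le y$ and $\sigma(x,y)\sigma(y,z)=\sigma(x,z)$ for $x\le y\le z$. A derivation $D:FI(X,K)\to I(X,K)$ is a $K$-linear map with $D(fg)=D(f)g+fD(g)$; it is inner if there is $i\in I(X,K)$ with $D(f)=fi-if$ for all $f$. Let $e_x\in FI(X,K)$ be $1$ at $(x,x)$ and $0$ elsewhere. An anti-automorphism (involution) $\Phi$ of $D(X,K)$ induces the anti-automorphism (involution) $\lambda$ of $X$ such that $\Phi\left(\begin{bmatrix}e_x\\0\end{bmatrix}\right)$ is conjugate to $\begin{bmatrix}e_{\lambda(x)}\\0\end{bmatrix}$ for every $x\in X$. For an anti-automorphism $\lambda$ of $X$, $\widetilde{\rho_\lambda}\left(\begin{bmatrix}f\\ i\end{bmatrix}\right)=\begin{bmatrix}f'\\ i'\end{bmatrix}$ with $f'(x,y)=f(\lambda^{-1}(y),\lambda^{-1}(x))$ and $i'(x,y)=i(\lambda^{-1}(y),\lambda^{-1}(x))$. For $k\in K^*$, $\widetilde{k\delta}\left(\begin{bmatrix}f\\ i\end{bmatrix}\right)=\begin{bmatrix}f\\ ki\end{bmatrix}$. *)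

(* Defs.v *)
From HB Require Import structures.
From mathcomp Require Import all_boot all_order all_algebra.
From mathcomp Require Import mathcomp_extra boolp classical_sets functions.
From mathcomp Require Import cardinality fsbigop.

Set Implicit Arguments.
Unset Strict Implicit.
Unset Printing Implicit Defensive.

Import Order.TTheory GRing.Theory.
Local Open Scope classical_set_scope.
Local Open Scope ring_scope.

Section Posets.
Context {d : Order.disp_t} (X : porderType d).

Definition poset_connected : Prop :=
  forall x y : X, exists2 p : seq X,
    path (fun a b : X => (a >=< b)%O) x p & last x p = y.

(* The inverse is part of the data; it is determined by the map. *)
Record poset_antiaut := PosetAntiaut {
  pa_fun :> X -> X;
  pa_inv : X -> X;
  pa_funK : cancel pa_fun pa_inv;
  pa_invK : cancel pa_inv pa_fun;
  pa_anti : forall x y : X, (x <= y)%O = (pa_fun y <= pa_fun x)%O }.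

Lemma pa_inv_anti (l : poset_antiaut) (x y : X) :
  (x <= y)%O = (pa_inv l y <= pa_inv l x)%O.
Proof. by rewrite [RHS](pa_anti l) !pa_invK. Qed.

Definition poset_involution (l : poset_antiaut) : Prop := involutive l.

End Posets.

(* Algebras here are a pzRingType with a compatible lmodType structure rather *)
(* than an algType: for the empty poset FI(X,K) and D(X,K) are the zero ring. *)

Section RingMaps.
Variable R : pzRingType.

Definition inner_automorphism (phi : R -> R) : Prop :=
  exists u v : R, [/\ u * v = 1, v * u = 1 & forall a, phi a = u * a * v].

Definition ring_conjugate (a b : R) : Prop :=
  exists u v : R, [/\ u * v = 1, v * u = 1 & b = u * a * v].

End RingMaps.

Section IncidenceSpace.
Context {d : Order.disp_t} (X : porderType d) (K : fieldType).

Definition incidence_pred : {pred (X -> X -> K)} :=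
  fun f => `[< forall x y : X, ~~ (x <= y)%O -> f x y = 0 >].

Lemma incidence_zmod_closed : zmod_closed incidence_pred.
Proof.
split; first by apply/asboolP.
move=> f g /asboolP f0 /asboolP g0; apply/asboolP => x y xy.
have -> : (f - g) x y = f x y - g x y by [].
by rewrite f0// g0// subrr.
Qed.

HB.instance Definition _ :=
  GRing.isZmodClosed.Build (X -> X -> K) incidence_pred incidence_zmod_closed.

Record incidence := Incidence {
  incidence_val :> X -> X -> K;
  incidenceP : incidence_val \in incidence_pred }.

HB.instance Definition _ := [isSub for incidence_val].
HB.instance Definition _ := [Choice of incidence by <:].
HB.instance Definition _ := [SubChoice_isSubZmodule of incidence by <:].

Lemma incidence_out (f : incidence) (x y : X) : ~~ (x <= y)%O -> f x y = 0.
Proof. by move: (incidenceP f) => /asboolP; apply. Qed.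

Lemma incidence_neq0 (f : incidence) (x y : X) : f x y != 0 -> (x <= y)%O.
Proof. by apply: contraNT => xy; rewrite incidence_out. Qed.

Lemma incidence_ext (f g : incidence) : (forall x y, f x y = g x y) -> f = g.
Proof. by move=> fg; apply/val_inj/funext => x; apply/funext => y; exact: fg. Qed.

Lemma incidenceD (f g : incidence) x y : (f + g) x y = f x y + g x y.
Proof. by []. Qed.

Lemma incidence_scale_subproof (a : K) (f : incidence) :
  (fun x y => a * f x y) \in incidence_pred.
Proof. by apply/asboolP => x y xy; rewrite incidence_out// mulr0. Qed.

Definition incidence_scale (a : K) (f : incidence) : incidence :=
  Incidence (incidence_scale_subproof a f).

Lemma incidence_scaleA (a b : K) (f : incidence) :
  incidence_scale a (incidence_scale b f) = incidence_scale (a * b) f.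
Proof. by apply: incidence_ext => x y /=; rewrite mulrA. Qed.

Lemma incidence_scale1 : left_id 1 incidence_scale.
Proof. by move=> f; apply: incidence_ext => x y /=; rewrite mul1r. Qed.

Lemma incidence_scaleDr : right_distributive incidence_scale +%R.
Proof.
by move=> a f g; apply: incidence_ext => x y; rewrite incidenceD /= -mulrDr.
Qed.

Lemma incidence_scaleDl (f : incidence) :
  {morph incidence_scale^~ f : a b / a + b}.
Proof.
by move=> a b; apply: incidence_ext => x y; rewrite incidenceD /= -mulrDl.
Qed.

HB.instance Definition _ := GRing.Zmodule_isLmodule.Build K incidence
  incidence_scaleA incidence_scale1 incidence_scaleDr incidence_scaleDl.

Lemma incidenceZ (a : K) (f : incidence) x y : (a *: f) x y = a * f x y.
Proof. by []. Qed.

Lemma incidence0 x y : (0 : incidence) x y = 0.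
Proof. by []. Qed.

(* For u <= v the interval [u, v] determines (u, v), so subintervals with     *)
(* distinct endpoints are counted as pairs u < v.                             *)
Definition fi_support (f : X -> X -> K) (x y : X) : set (X * X) :=
  [set p | [/\ (x <= p.1)%O, (p.1 < p.2)%O, (p.2 <= y)%O & f p.1 p.2 != 0]].

Definition finitary_pred : {pred incidence} :=
  fun f => `[< forall x y : X, (x <= y)%O -> finite_set (fi_support f x y) >].

Lemma finitary_submod_closed : submod_closed finitary_pred.
Proof.
split.
  apply/asboolP => x y xy.
  by apply: (@sub_finite_set _ _ set0) => // p [_ _ _]; rewrite eqxx.
move=> a f g /asboolP ff /asboolP gf; apply/asboolP => x y xy.
apply: (@sub_finite_set _ _ (fi_support f x y `|` fi_support g x y)); last first.
  by rewrite finite_setU; split; [exact: ff|exact: gf].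
move=> [u v] [xu uv vy] h.
have {}h : a * f u v + g u v != 0 by [].
have [f0|f0] := eqVneq (f u v) 0; last by left.
by right; split => //=; move: h; rewrite f0 mulr0 add0r.
Qed.

HB.instance Definition _ :=
  GRing.isSubmodClosed.Build K incidence finitary_pred finitary_submod_closed.

Record finitary := Finitary {
  finitary_val :> incidence;
  finitaryP : finitary_val \in finitary_pred }.

HB.instance Definition _ := [isSub for finitary_val].
HB.instance Definition _ := [Choice of finitary by <:].
HB.instance Definition _ := [SubChoice_isSubLmodule of finitary by <:].

Lemma finitary_fin (f : finitary) (x y : X) : finite_set (fi_support f x y).
Proof.
have [xy|xy] := boolP (x <= y)%O.
  by move: (finitaryP f) => /asboolP; apply.
apply: (@sub_finite_set _ _ set0) => // -[u v] [/= xu uv vy _].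
by case/negP: xy; exact: le_trans xu (le_trans (ltW uv) vy).
Qed.

Lemma finitary_ext (f g : finitary) : (forall x y, f x y = g x y) -> f = g.
Proof. by move=> fg; apply/val_inj/incidence_ext. Qed.

End IncidenceSpace.

Arguments incidence_pred {d} X K _.
Arguments finitary_pred {d} X K _.

Section Convolution.
Context {d : Order.disp_t} {X : porderType d} {K : fieldType}.
Implicit Types (i j k : incidence X K) (f g : finitary X K).

(* \sum_(z \in A) sums over the nonzero terms; there are finitely many of     *)
(* them as soon as one of the two factors is finitary.                        *)
Definition iconv_fun (a b : X -> X -> K) (x y : X) : K :=
  \sum_(z \in [set z : X | (x <= z <= y)%O]) a x z * b z y.

Lemma iconv_incidence (a b : X -> X -> K) :
  iconv_fun a b \in incidence_pred X K.
Proof.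
apply/asboolP => x y xy; apply: fsbig1 => z /andP[xz zy].
by case/negP: xy; exact: le_trans xz zy.
Qed.

Definition iconv i j : incidence X K := Incidence (iconv_incidence i j).

Lemma iconvE i j (r : seq X) x y : uniq r ->
  (forall z, i x z != 0 -> j z y != 0 -> z \in r) ->
  iconv i j x y = \sum_(z <- r) i x z * j z y.
Proof.
move=> ur hr; rewrite /= /iconv_fun.
have sub : [set` [seq z <- r | (x <= z <= y)%O]] `<=`
    [set z : X | (x <= z <= y)%O].
  by move=> z; rewrite /= mem_filter => /andP[].
rewrite (fsbigE _ _ (filter_uniq _ ur) sub); last first.
  move=> z /= /andP[xz zy]; rewrite mem_filter xz zy /= => zr.
  have [->|iz] := eqVneq (i x z) 0; first by rewrite mul0r.
  have [->|jz] := eqVneq (j z y) 0; first by rewrite mulr0.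
  by rewrite hr in zr.
rewrite big_filter_cond [RHS](bigID (fun z => (x <= z <= y)%O))/=.
rewrite [X in _ = _ + X]big1 ?addr0.
  by apply: eq_bigl => z; rewrite andb_idr// => h; exact: mem_set.
move=> z; rewrite negb_and => /orP[h|h].
  by rewrite incidence_out// mul0r.
by rewrite [X in _ * X]incidence_out// mulr0.
Qed.

(* A finite set containing both endpoints of all nonzero strict entries of f  *)
(* inside [x, y], together with x and y.                                      *)
Lemma finitary_nodes f x y : exists r : seq X,
  [/\ x \in r, y \in r & forall u v, (x <= u)%O -> (v <= y)%O -> (u < v)%O ->
     f u v != 0 -> u \in r /\ v \in r].
Proof.
have /finite_seqP[s hs] := finitary_fin f x y.
exists (x :: y :: unzip1 s ++ unzip2 s); split; rewrite ?inE ?eqxx ?orbT//.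
move=> u v xu vy uv fuv.
have : fi_support f x y (u, v) by [].
rewrite hs /= => uvs.
rewrite !inE !mem_cat.
have -> : u \in unzip1 s by apply/mapP; exists (u, v).
have -> : v \in unzip2 s by apply/mapP; exists (u, v).
by rewrite !orbT.
Qed.

Lemma finitary_nodes2 f g x y : exists r : seq X,
  [/\ uniq r, x \in r, y \in r &
    forall u v, (x <= u)%O -> (v <= y)%O -> (u < v)%O ->
     f u v != 0 \/ g u v != 0 -> u \in r /\ v \in r].
Proof.
have [r [xr yr hr]] := finitary_nodes f x y.
have [s [xs ys hs]] := finitary_nodes g x y.
exists (undup (r ++ s)); split; rewrite ?undup_uniq ?mem_undup ?mem_cat ?xr ?yr//.
move=> u v xu vy uv [] h; rewrite !mem_undup !mem_cat.
  by have [-> ->] := hr u v xu vy uv h.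
by have [-> ->] := hs u v xu vy uv h; rewrite !orbT.
Qed.

Lemma iconv_finitary f g : iconv f g \in finitary_pred X K.
Proof.
apply/asboolP => x y xy.
have [r [ur xr yr hr]] := finitary_nodes2 f g x y.
apply: (@sub_finite_set _ _ ([set` r] `*` [set` r])); last first.
  by apply: finite_setX; exact: finite_seq.
move=> [u v] [/= xu uv vy h].
have [z [uz zv fz gz]] :
    exists z, [/\ (u <= z)%O, (z <= v)%O, f u z != 0 & g z v != 0].
  apply: contrapT => hn; move/negP: h; apply; apply/eqP.
  apply: fsbig1 => z /andP[uz zv]; apply/eqP; rewrite mulf_eq0.
  by apply/negP => /negP; rewrite negb_or => /andP[? ?]; apply: hn; exists z.
have xz := le_trans xu uz; have zy := le_trans zv vy.
split => /=.
  have [e|nuz] := eqVneq u z.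
    by have [|] := hr u v xu vy uv; first by right; rewrite e.
  by have [||] := hr u z xu zy _ _ => //; [rewrite lt_neqAle nuz|left].
have [e|nzv] := eqVneq z v.
  by have [|] := hr u v xu vy uv; first by left; rewrite -e.
by have [||] := hr z v xz vy _ _ => //; [rewrite lt_neqAle nzv|right].
Qed.

Lemma delta_incidence :
  (fun x y : X => (x == y)%:R) \in incidence_pred X K.
Proof.
by apply/asboolP => x y; case: eqVneq => // ->; rewrite lexx.
Qed.

Definition delta_inc : incidence X K := Incidence delta_incidence.

Lemma delta_finitary : delta_inc \in finitary_pred X K.
Proof.
apply/asboolP => x y xy; apply: (@sub_finite_set _ _ set0) => //.
by move=> [u v] [/= _ /lt_eqF -> _]; rewrite eqxx.
Qed.

Definition fi_mul f g : finitary X K := Finitary (iconv_finitary f g).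
Definition fi_one : finitary X K := Finitary delta_finitary.

Lemma iconv1l i : iconv fi_one i = i.
Proof.
apply: incidence_ext => x y; rewrite (@iconvE _ _ [:: x])//.
  by rewrite big_seq1 /= eqxx mul1r.
by move=> z /=; rewrite inE (eq_sym z); case: (eqVneq x z) => //=; rewrite eqxx.
Qed.

Lemma iconv1r i : iconv i fi_one = i.
Proof.
apply: incidence_ext => x y; rewrite (@iconvE _ _ [:: y])//.
  by rewrite big_seq1 /= eqxx mulr1.
by move=> z /= _; rewrite inE; case: (eqVneq z y) => //=; rewrite eqxx.
Qed.

Lemma nodes_r (r : seq X) f x y z : (z <= y)%O -> x \in r ->
  (forall u v, (x <= u)%O -> (v <= y)%O -> (u < v)%O ->
     f u v != 0 -> u \in r /\ v \in r) ->
  f x z != 0 -> z \in r.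
Proof.
move=> zy xr hr fz; have := incidence_neq0 fz.
rewrite le_eqVlt => /predU1P[<-//|xz].
by have [] := hr x z (lexx x) zy xz fz.
Qed.

Lemma nodes_l (r : seq X) f x y z : (x <= z)%O -> y \in r ->
  (forall u v, (x <= u)%O -> (v <= y)%O -> (u < v)%O ->
     f u v != 0 -> u \in r /\ v \in r) ->
  f z y != 0 -> z \in r.
Proof.
move=> xz yr hr fz; have := incidence_neq0 fz.
rewrite le_eqVlt => /predU1P[->//|zy].
by have [] := hr z y xz (lexx y) zy fz.
Qed.

Lemma iconvDl f i j : iconv f (i + j) = iconv f i + iconv f j.
Proof.
apply: incidence_ext => x y; have [r [ur xr yr hr]] := finitary_nodes2 f f x y.
have h k z : f x z != 0 -> k z y != 0 -> z \in r.
  move=> fz /incidence_neq0 zy.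
  by apply: (nodes_r zy xr _ fz) => u v xu vy uv n; apply: hr => //; left.
rewrite incidenceD !(@iconvE _ _ r)//; do ?by move=> z; exact: h.
by rewrite -big_split; apply: eq_bigr => z _; rewrite incidenceD mulrDr.
Qed.

Lemma iconvDr i j f : iconv (i + j) f = iconv i f + iconv j f.
Proof.
apply: incidence_ext => x y; have [r [ur xr yr hr]] := finitary_nodes2 f f x y.
have h k z : k x z != 0 -> f z y != 0 -> z \in r.
  move=> /incidence_neq0 xz fz.
  by apply: (nodes_l xz yr _ fz) => u v xu vy uv n; apply: hr => //; left.
rewrite incidenceD !(@iconvE _ _ r)//; do ?by move=> z; exact: h.
by rewrite -big_split; apply: eq_bigr => z _; rewrite incidenceD mulrDl.
Qed.

Lemma iconvDfl f g i : iconv (f + g) i = iconv f i + iconv g i.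
Proof.
apply: incidence_ext => x y; have [r [ur xr yr hr]] := finitary_nodes2 f g x y.
have hf z : f x z != 0 -> i z y != 0 -> z \in r.
  move=> fz /incidence_neq0 zy.
  by apply: (nodes_r zy xr _ fz) => u v xu vy uv n; apply: hr => //; left.
have hg z : g x z != 0 -> i z y != 0 -> z \in r.
  move=> gz /incidence_neq0 zy.
  by apply: (nodes_r zy xr _ gz) => u v xu vy uv n; apply: hr => //; right.
rewrite incidenceD (@iconvE f _ r)// (@iconvE g _ r)// (@iconvE _ _ r)//.
  by rewrite -big_split; apply: eq_bigr => z _; rewrite incidenceD mulrDl.
move=> z; rewrite incidenceD; have [->|fz _] := eqVneq (f x z) 0; last exact: hf.
by rewrite add0r; exact: hg.
Qed.

Lemma iconvDfr i f g : iconv i (f + g) = iconv i f + iconv i g.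
Proof.
apply: incidence_ext => x y; have [r [ur xr yr hr]] := finitary_nodes2 f g x y.
have hf z : i x z != 0 -> f z y != 0 -> z \in r.
  move=> /incidence_neq0 xz fz.
  by apply: (nodes_l xz yr _ fz) => u v xu vy uv n; apply: hr => //; left.
have hg z : i x z != 0 -> g z y != 0 -> z \in r.
  move=> /incidence_neq0 xz gz.
  by apply: (nodes_l xz yr _ gz) => u v xu vy uv n; apply: hr => //; right.
rewrite incidenceD (@iconvE _ f r)// (@iconvE _ g r)// (@iconvE _ _ r)//.
  by rewrite -big_split; apply: eq_bigr => z _; rewrite incidenceD mulrDr.
move=> z iz; rewrite incidenceD; have [->|fz _] := eqVneq (f z y) 0; last exact: hf.
by rewrite add0r; exact: hg.
Qed.

Lemma iconvZl (c : K) i j : iconv (c *: i) j = c *: iconv i j.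
Proof.
apply: incidence_ext => x y; rewrite incidenceZ /= /iconv_fun mulr_fsumr.
by apply: eq_fsbigr => z _; rewrite mulrA.
Qed.

Lemma iconvZr (c : K) i j : iconv i (c *: j) = c *: iconv i j.
Proof.
apply: incidence_ext => x y; rewrite incidenceZ /= /iconv_fun mulr_fsumr.
by apply: eq_fsbigr => z _; rewrite mulrCA.
Qed.

(* Both iterated products are sums over one finite set of nodes. *)
Lemma iconvA_nodes i j k (r : seq X) x y : uniq r ->
  (forall z, i x z != 0 -> (z <= y)%O -> z \in r) ->
  (forall z w, z \in r -> (x <= z)%O -> (w <= y)%O ->
     j z w != 0 -> k w y != 0 -> w \in r) ->
  (forall w, (x <= w)%O -> (w <= y)%O -> iconv i j x w != 0 -> k w y != 0 ->
     w \in r) ->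
  iconv i (iconv j k) x y = iconv (iconv i j) k x y.
Proof.
move=> ur hi hjk hij.
rewrite (@iconvE _ _ r)//; last first.
  by move=> z iz /incidence_neq0; exact: hi.
rewrite (@iconvE (iconv i j) _ r)//; last first.
  move=> w ijw kw; apply: hij => //; first exact: incidence_neq0 ijw.
  exact: incidence_neq0 kw.
transitivity (\sum_(z <- r) \sum_(w <- r) i x z * (j z w * k w y)).
  rewrite big_seq [RHS]big_seq; apply: eq_bigr => z zr.
  have [->|iz] := eqVneq (i x z) 0.
    by rewrite mul0r big1// => w _; rewrite mul0r.
  rewrite (@iconvE _ _ r)// ?mulr_sumr// => w jzw kw.
  by apply: (hjk z) => //; [exact: incidence_neq0 iz|exact: incidence_neq0 kw].
rewrite exchange_big; apply: eq_bigr => w _.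
have [->|kw] := eqVneq (k w y) 0.
  by rewrite mulr0 big1// => z _; rewrite !mulr0.
rewrite (@iconvE _ _ r)//.
  by rewrite mulr_suml; apply: eq_bigr => z _; rewrite mulrA.
move=> z iz jzw; apply: hi => //.
by apply: le_trans (incidence_neq0 jzw) (incidence_neq0 kw).
Qed.

Lemma iconv_neq0 i j x y : iconv i j x y != 0 ->
  exists z, [/\ (x <= z)%O, (z <= y)%O, i x z != 0 & j z y != 0].
Proof.
move=> h; apply: contrapT => hn; move/negP: h; apply; apply/eqP.
apply: fsbig1 => z /andP[uz zv]; apply/eqP; rewrite mulf_eq0.
by apply/negP => /negP; rewrite negb_or => /andP[? ?]; apply: hn; exists z.
Qed.

Lemma iconvA_ffi f g i : iconv f (iconv g i) = iconv (iconv f g) i.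
Proof.
apply: incidence_ext => x y; have [r [ur xr yr hr]] := finitary_nodes2 f g x y.
have hf z : f x z != 0 -> (z <= y)%O -> z \in r.
  move=> fz zy.
  by apply: (nodes_r zy xr _ fz) => u v xu vy uv n; apply: hr => //; left.
have hg z w : z \in r -> (x <= z)%O -> (w <= y)%O -> g z w != 0 -> w \in r.
  move=> zr xz wy gw; have := incidence_neq0 gw.
  rewrite le_eqVlt => /predU1P[<-//|zw].
  by have [] := hr z w xz wy zw (or_intror gw).
apply: (@iconvA_nodes _ _ _ r) => //; first by move=> z w zr xz wy gz _; exact: hg gz.
move=> w xw wy /iconv_neq0[z [xz zw fz gz]] _.
by apply: (hg z) => //; apply: hf => //; exact: le_trans wy.
Qed.

Lemma iconvA_fif f i g : iconv f (iconv i g) = iconv (iconv f i) g.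
Proof.
apply: incidence_ext => x y; have [r [ur xr yr hr]] := finitary_nodes2 f g x y.
have hg w : (x <= w)%O -> g w y != 0 -> w \in r.
  move=> xw gw.
  by apply: (nodes_l xw yr _ gw) => u v xu vy uv n; apply: hr => //; right.
apply: (@iconvA_nodes _ _ _ r) => //.
- move=> z fz zy.
  by apply: (nodes_r zy xr _ fz) => u v xu vy uv n; apply: hr => //; left.
- move=> z w _ xz _ /incidence_neq0 zw; apply: hg; exact: le_trans zw.
- by move=> w xw _ _; exact: hg.
Qed.

Lemma iconvA_iff i f g : iconv i (iconv f g) = iconv (iconv i f) g.
Proof.
apply: incidence_ext => x y; have [r [ur xr yr hr]] := finitary_nodes2 f g x y.
have hg w : (x <= w)%O -> g w y != 0 -> w \in r.
  move=> xw gw.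
  by apply: (nodes_l xw yr _ gw) => u v xu vy uv n; apply: hr => //; right.
have hf z w : w \in r -> (x <= z)%O -> (w <= y)%O -> f z w != 0 -> z \in r.
  move=> wr xz wy fw; have := incidence_neq0 fw.
  rewrite le_eqVlt => /predU1P[->//|zw].
  by have [] := hr z w xz wy zw (or_introl fw).
rewrite (@iconvE _ _ r)//; last first.
  move=> z /incidence_neq0 xz /iconv_neq0[w [zw wy fz gw]].
  by apply: (hf _ w) => //; apply: hg => //; exact: le_trans zw.
rewrite (@iconvE (iconv i f) _ r)//; last first.
  by move=> w /incidence_neq0 xw; exact: hg.
transitivity (\sum_(z <- r) \sum_(w <- r) i x z * (f z w * g w y)).
  apply: eq_bigr => z _; have [->|iz] := eqVneq (i x z) 0.
    by rewrite mul0r big1// => w _; rewrite mul0r.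
  rewrite (@iconvE _ _ r)// ?mulr_sumr// => w /incidence_neq0 zw.
  by apply: hg; exact: le_trans (incidence_neq0 iz) zw.
rewrite exchange_big big_seq [RHS]big_seq; apply: eq_bigr => w wr.
have [->|gw] := eqVneq (g w y) 0.
  by rewrite mulr0 big1// => z _; rewrite !mulr0.
rewrite (@iconvE _ _ r)//.
  by rewrite mulr_suml; apply: eq_bigr => z _; rewrite mulrA.
move=> z /incidence_neq0 xz fz.
by apply: (hf _ w) => //; exact: incidence_neq0 gw.
Qed.

Lemma fi_mulA : associative fi_mul.
Proof. by move=> f g h; apply/val_inj/iconvA_ffi. Qed.
Lemma fi_mul1l : left_id fi_one fi_mul.
Proof. by move=> f; apply/val_inj/iconv1l. Qed.
Lemma fi_mul1r : right_id fi_one fi_mul.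
Proof. by move=> f; apply/val_inj/iconv1r. Qed.
Lemma fi_mulDl : left_distributive fi_mul +%R.
Proof. by move=> f g h; apply/val_inj/iconvDr. Qed.
Lemma fi_mulDr : right_distributive fi_mul +%R.
Proof. by move=> f g h; apply/val_inj/iconvDl. Qed.

HB.instance Definition _ := GRing.Zmodule_isPzRing.Build (finitary X K)
  fi_mulA fi_mul1l fi_mul1r fi_mulDl fi_mulDr.

Lemma finitaryME f g : f * g = iconv f g :> incidence X K.
Proof. by []. Qed.

Lemma finitary_scalerAl (c : K) f g : c *: (f * g) = (c *: f) * g.
Proof. by apply/val_inj; rewrite /= iconvZl. Qed.

Lemma finitary_scalerAr (c : K) f g : c *: (f * g) = f * (c *: g).
Proof. by apply/val_inj; rewrite /= iconvZr. Qed.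

End Convolution.

Definition Dalg {d : Order.disp_t} (X : porderType d) (K : fieldType) : Type :=
  (finitary X K * incidence X K)%type.

Section DAlgebra.
Context {d : Order.disp_t} {X : porderType d} {K : fieldType}.

HB.instance Definition _ := GRing.Lmodule.copy (Dalg X K)
  (finitary X K * incidence X K)%type.

Implicit Types a b c : Dalg X K.

Lemma D_ext a b : a.1 = b.1 -> a.2 = b.2 -> a = b.
Proof. by case: a b => [f i] [g j] /= -> ->. Qed.

Definition D_mul a b : Dalg X K :=
  (a.1 * b.1, iconv a.1 b.2 + iconv a.2 b.1).
Definition D_one : Dalg X K := (1, 0).

Lemma iconv0l (f : finitary X K) : iconv 0 f = 0.
Proof. by have := iconvZl 0 0 f; rewrite !scale0r. Qed.

Lemma iconv0r (f : finitary X K) : iconv f 0 = 0.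
Proof. by have := iconvZr 0 f 0; rewrite !scale0r. Qed.

Lemma D_mulA : associative D_mul.
Proof.
move=> a b c; apply: D_ext => /=; first exact: mulrA.
by rewrite iconvDl iconvDr addrA iconvA_ffi iconvA_fif iconvA_iff.
Qed.
Lemma D_mul1l : left_id D_one D_mul.
Proof.
by move=> [f i]; apply: D_ext => /=; rewrite ?mul1r// iconv1l iconv0l addr0.
Qed.
Lemma D_mul1r : right_id D_one D_mul.
Proof.
by move=> [f i]; apply: D_ext => /=; rewrite ?mulr1// iconv1r iconv0r add0r.
Qed.
Lemma D_mulDl : left_distributive D_mul +%R.
Proof.
move=> a b c; apply: D_ext => /=; first exact: mulrDl.
by rewrite iconvDfl iconvDr addrACA.
Qed.
Lemma D_mulDr : right_distributive D_mul +%R.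
Proof.
move=> a b c; apply: D_ext => /=; first exact: mulrDr.
by rewrite iconvDl iconvDfr addrACA.
Qed.

HB.instance Definition _ := GRing.Zmodule_isPzRing.Build (Dalg X K)
  D_mulA D_mul1l D_mul1r D_mulDl D_mulDr.

Lemma DalgME a b : a * b = D_mul a b.
Proof. by []. Qed.

Lemma D_scalerAl (k : K) a b : k *: (a * b) = (k *: a) * b.
Proof.
apply: D_ext => /=; first exact: finitary_scalerAl.
by rewrite scalerDr !iconvZl.
Qed.

Lemma D_scalerAr (k : K) a b : k *: (a * b) = a * (k *: b).
Proof.
apply: D_ext => /=; first exact: finitary_scalerAr.
by rewrite scalerDr !iconvZr.
Qed.

Definition D_anti_automorphism (Phi : Dalg X K -> Dalg X K) : Prop :=
  [/\ linear Phi, bijective Phi & forall a b, Phi (a * b) = Phi b * Phi a].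

Definition D_involution (Phi : Dalg X K -> Dalg X K) : Prop :=
  D_anti_automorphism Phi /\ involutive Phi.

Definition mult_cocycle (s : incidence X K) : Prop :=
  (forall x y : X, (x <= y)%O -> s x y != 0) /\
  (forall x y z : X, (x <= y)%O -> (y <= z)%O -> s x y * s y z = s x z).

Lemma hadamard_incidence (s f : incidence X K) :
  (fun x y => s x y * f x y) \in incidence_pred X K.
Proof. by apply/asboolP => x y xy; rewrite incidence_out// mul0r. Qed.

Definition hadamard (s f : incidence X K) : incidence X K :=
  Incidence (hadamard_incidence s f).

Lemma hadamard_finitary (s : incidence X K) (f : finitary X K) :
  hadamard s f \in finitary_pred X K.
Proof.
apply/asboolP => x y _; apply: sub_finite_set (finitary_fin f x y).
move=> [u v] [/= xu uv vy sf]; split => //=.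
by apply: contraNN sf => /eqP ->; rewrite mulr0.
Qed.

Definition mult_map (s : incidence X K) (f : finitary X K) : finitary X K :=
  Finitary (hadamard_finitary s f).

Definition fi_derivation (D : finitary X K -> incidence X K) : Prop :=
  linear D /\ forall f g : finitary X K, D (f * g) = iconv (D f) g + iconv f (D g).

Definition fi_inner_derivation (D : finitary X K -> incidence X K) : Prop :=
  exists i : incidence X K, forall f, D f = iconv f i - iconv i f.

Lemma idem_incidence (x : X) :
  (fun u v : X => ((u == x) && (v == x))%:R) \in incidence_pred X K.
Proof.
apply/asboolP => u v; have [->|//] := eqVneq u x.
by have [->|//] := eqVneq v x; rewrite lexx.
Qed.

Lemma idem_finitary (x : X) :
  Incidence (idem_incidence x) \in finitary_pred X K.
Proof.
apply/asboolP => a b _; apply: (@sub_finite_set _ _ set0) => //.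
move=> [u v] [/= _ uv _]; have [ux|] := eqVneq u x; last by rewrite eqxx.
have [vx|] := eqVneq v x; last by rewrite eqxx.
by move: uv; rewrite ux vx ltxx.
Qed.

Definition fi_idem (x : X) : finitary X K := Finitary (idem_finitary x).

Lemma iconv_diag (i j : incidence X K) (x : X) : iconv i j x x = i x x * j x x.
Proof.
rewrite (@iconvE _ _ _ _ _ [:: x]) ?big_seq1// => z.
by move=> /incidence_neq0 xz /incidence_neq0 zx; rewrite inE eq_le zx xz.
Qed.

Definition induced_by (Phi : Dalg X K -> Dalg X K) (l : X -> X) : Prop :=
  forall x : X,
    ring_conjugate (Phi ((fi_idem x, 0) : Dalg X K)) ((fi_idem (l x), 0) : Dalg X K).

Lemma induced_by_unique (Phi : Dalg X K -> Dalg X K) (l l' : X -> X) :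
  induced_by Phi l -> induced_by Phi l' -> l =1 l'.
Proof.
move=> hl hl' x; have [u [v [_ vu e]]] := hl x.
have [u' [v' [_ _ e']]] := hl' x.
have eP : Phi (fi_idem x, 0) = v * ((fi_idem (l x), 0) : Dalg X K) * u.
  by rewrite e !mulrA vu mul1r -mulrA vu mulr1.
move: e'; rewrite eP => /(congr1 (fun a : Dalg X K => a.1 (l' x) (l' x))).
have D_diag a b y : (a * b).1 y y = a.1 y y * b.1 y y by exact: iconv_diag.
rewrite !D_diag /= !eqxx; have [//|_] := eqVneq (l' x) (l x).
by rewrite mulr0 mul0r mulr0 mul0r => /eqP; rewrite oner_eq0.
Qed.

Lemma rho_incidence (l : poset_antiaut X) (i : incidence X K) :
  (fun x y => i (pa_inv l y) (pa_inv l x)) \in incidence_pred X K.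
Proof.
by apply/asboolP => x y xy; rewrite incidence_out// -pa_inv_anti.
Qed.

Definition rho_inc (l : poset_antiaut X) (i : incidence X K) : incidence X K :=
  Incidence (rho_incidence l i).

Lemma rho_finitary (l : poset_antiaut X) (f : finitary X K) :
  rho_inc l f \in finitary_pred X K.
Proof.
apply/asboolP => x y _.
apply: sub_finite_set (finite_image (fun p => (l p.2, l p.1))
  (finitary_fin f (pa_inv l y) (pa_inv l x))).
move=> [u v] [/= xu uv vy fuv]; exists (pa_inv l v, pa_inv l u) => /=; last first.
  by rewrite !pa_invK.
split => //=; rewrite -?pa_inv_anti//.
by rewrite lt_neqAle -pa_inv_anti ltW// (can_eq (pa_invK l)) eq_sym lt_eqF.
Qed.

Definition rho_fi (l : poset_antiaut X) (f : finitary X K) : finitary X K :=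
  Finitary (rho_finitary l f).

Definition rho_tilde (l : poset_antiaut X) (a : Dalg X K) : Dalg X K :=
  (rho_fi l a.1, rho_inc l a.2).

Definition kdelta_tilde (k : K) (a : Dalg X K) : Dalg X K := (a.1, k *: a.2).

End DAlgebra.

(* Main.v *)
Require Import Defs.
From mathcomp Require Import all_boot all_order all_algebra.
From mathcomp Require Import boolp classical_sets functions cardinality fsbigop.
From mathcomp Require Import ring.
Import Order.TTheory GRing.Theory.
Local Open Scope ring_scope.

Set Implicit Arguments.
Unset Strict Implicit.
Unset Printing Implicit Defensive.

(** Write [e_x] for [Didem x], the diagonal idempotent of [D(X,K)] at [x].

    An element of [FI(X,K)], or of [D(X,K)], is a unit as soon as the diagonal
    entries of its finitary part are nonzero ([fi_invertible_diag], [D_invertible_diag]):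
    inside an interval a strictly upper triangular finitary element is
    nilpotent, so a geometric series inverts it.  Hence every idempotent is
    conjugate to its diagonal ([D_idem_conj_diag]).  If [Phi] is an
    anti-automorphism, the idempotent [Phi e_x] is primitive like [e_x], so its
    diagonal is a single [e_(l x)]; since [x <= y] means [e_x D e_y <> 0], the
    map [l] reverses the order ([anti_induced]).

    Composing [Phi] with the inverse of [rho_tilde l] gives an automorphism
    [phi] with [phi e_x] conjugate to [e_x] for each [x].  The element whose
    column at [x] is that of [phi e_x] conjugates all the [e_x] at once, provided
    that it is finitary ([simultaneous_conj]).  This is the delicate point: the
    images under [phi] of the idempotents of arbitrary subsets of [X] are
    finitary, and an infinite combinatorial argument ([finite_S]) deduces that
    the columns, taken together, have finitely many nonzero entries in each
    interval.

    An automorphism fixing every [e_x] acts entry by entry.  On [FI(X,K)] it is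
    given by a multiplicative cocycle [s] and, with values in [I(X,K)], by [s]
    times an additive cocycle; on [I(X,K)] it is [k s], where [k] is constant
    because [X] is connected.  The two hypotheses on [X] make both cocycles
    inner ([fixing_idem_normal_form]), whence the decomposition
    ([anti_automorphism_decomp]).  When [Phi] is an involution, its square
    multiplies the diagonal entries of elements of [I(X,K)] by [k ^+ 2]
    ([involution_scalar]).

    If [x0] is comparable with all elements, a cocycle is the coboundary of its
    values between [x0] and the other elements ([mult_cocycle_inner]), and a
    derivation is, up to an inner one, given by an additive cocycle
    ([derivation_idem], [derivation_cocycle]). *)

(** * Entries of convolution products and matrix units *)

Section Entries.
Context {d : Order.disp_t} {X : porderType d} {K : fieldType}.
Implicit Types (i j : incidence X K) (f g : finitary X K) (a b : Dalg X K).
Implicit Types (x y z : X).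

(** A product entry to which only one intermediate point contributes. *)
Lemma iconv_single i j x y z :
  (forall w, i x w != 0 -> j w z != 0 -> w = y) ->
  iconv i j x z = i x y * j y z.
Proof.
by move=> h; rewrite (@iconvE _ _ _ _ _ [:: y]) ?big_seq1// => w ix jw; rewrite inE (h w).
Qed.

Lemma incidenceN i x y : (- i) x y = - i x y.
Proof. by []. Qed.

Lemma iconvNl i j : iconv (- i) j = - iconv i j.
Proof. by rewrite -scaleN1r iconvZl scaleN1r. Qed.

Lemma iconvNr i j : iconv i (- j) = - iconv i j.
Proof. by rewrite -scaleN1r iconvZr scaleN1r. Qed.

Lemma fi_diag_incidence (h : X -> K) :
  (fun x y : X => (x == y)%:R * h x) \in incidence_pred X K.
Proof. by apply/asboolP => x y; case: eqVneq => [->|]; rewrite ?lexx ?mul0r. Qed.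

Lemma fi_diag_finitary (h : X -> K) :
  Incidence (fi_diag_incidence h) \in finitary_pred X K.
Proof.
apply/asboolP => x y _; apply: (@sub_finite_set _ _ set0) => //.
by move=> [u v] [/= _ /lt_eqF -> _]; rewrite mul0r eqxx.
Qed.

(** The diagonal element with diagonal entries [h]. *)
Definition fi_diag (h : X -> K) : finitary X K := Finitary (fi_diag_finitary h).

Lemma iconv_diagl h i x y : iconv (fi_diag h) i x y = h x * i x y.
Proof.
rewrite (@iconv_single _ _ _ x) /= ?eqxx ?mul1r// => w.
by case: (eqVneq x w) => [->//|_]; rewrite mul0r eqxx.
Qed.

Lemma iconv_diagr h i x y : iconv i (fi_diag h) x y = i x y * h y.
Proof.
rewrite (@iconv_single _ _ _ y) /= ?eqxx ?mul1r// => w _.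
by case: (eqVneq w y) => [->//|_]; rewrite mul0r eqxx.
Qed.

Lemma fi_diagM h h' : fi_diag h * fi_diag h' = fi_diag (fun x => h x * h' x).
Proof.
apply: finitary_ext => x y; rewrite finitaryME iconv_diagl /=.
by case: eqVneq => [->|]; rewrite ?mul0r ?mulr0 ?mul1r.
Qed.

Lemma fi_diag1 : fi_diag (fun=> 1) = 1.
Proof. by apply: finitary_ext => x y /=; rewrite mulr1. Qed.

Lemma fi_idemE x : fi_idem x = fi_diag (fun u => (u == x)%:R) :> finitary X K.
Proof.
apply: finitary_ext => u v /=.
case: (eqVneq u v) => [->|uv]; first by rewrite mul1r andbb.
by rewrite mul0r; case: (eqVneq u x) => // ux; rewrite -ux eq_sym (negbTE uv).
Qed.

Lemma iconv_ideml z i x y : iconv (fi_idem z) i x y = (x == z)%:R * i x y.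
Proof. by rewrite fi_idemE iconv_diagl. Qed.

Lemma iconv_idemr z i x y : iconv i (fi_idem z) x y = i x y * (y == z)%:R.
Proof. by rewrite fi_idemE iconv_diagr. Qed.

(** Embeddings of the two summands of [D(X,K)]. *)
Definition Dfi f : Dalg X K := (f, 0).
Definition Dinc i : Dalg X K := (0, i).

(** The idempotent of [D(X,K)] attached to the subset of [X] given by [A]. *)
Definition Dset (A : X -> bool) : Dalg X K := Dfi (fi_diag (fun x => (A x)%:R)).

(** The diagonal idempotent at [x] as an element of [D(X,K)]. *)
Definition Didem x : Dalg X K := Dfi (fi_idem x).

Lemma DidemE x : Didem x = Dset (fun u => u == x).
Proof. by rewrite /Didem fi_idemE. Qed.

Lemma iconv_zerol i : iconv 0 i = 0 :> incidence X K.
Proof. by have := iconvZl 0 0 i; rewrite !scale0r. Qed.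

Lemma iconv_zeror i : iconv i 0 = 0 :> incidence X K.
Proof. by have := iconvZr 0 i 0; rewrite !scale0r. Qed.

Lemma DM1 a b : (a * b).1 = a.1 * b.1.
Proof. by []. Qed.

Lemma DM2 a b : (a * b).2 = iconv a.1 b.2 + iconv a.2 b.1.
Proof. by []. Qed.

Lemma D1_diag a b x : (a * b).1 x x = a.1 x x * b.1 x x.
Proof. exact: iconv_diag. Qed.

Lemma D_eq a b : (forall x y, a.1 x y = b.1 x y) ->
  (forall x y, a.2 x y = b.2 x y) -> a = b.
Proof. by move=> h1 h2; apply: D_ext; [exact: finitary_ext|exact: incidence_ext]. Qed.

Lemma DfiM f g : Dfi f * Dfi g = Dfi (f * g).
Proof. by apply: D_ext => //=; rewrite iconv_zerol iconv_zeror addr0. Qed.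

Lemma DsetM A B : Dset A * Dset B = Dset (fun x => A x && B x).
Proof.
rewrite /Dset DfiM fi_diagM; congr (Dfi (fi_diag _)).
by apply/funext => x; rewrite -natrM mulnb.
Qed.

Lemma eq_Dset A B : A =1 B -> Dset A = Dset B.
Proof. by move=> AB; congr (Dset _); apply/funext. Qed.

Lemma Didem_idem x : Didem x * Didem x = Didem x.
Proof. by rewrite DidemE DsetM; apply: eq_Dset => y; rewrite andbb. Qed.

Lemma Didem_orth x y : x != y -> Didem x * Didem y = 0.
Proof.
move=> xy; rewrite !DidemE DsetM.
apply: D_eq => u v //=; case: eqVneq => [->|_]; rewrite ?mul0r// mul1r.
by case: eqVneq => // ->; rewrite (negbTE xy).
Qed.

Lemma Didem_neq0 x : Didem x != 0.
Proof.
apply/eqP => /(congr1 (fun a : Dalg X K => a.1 x x)) /=.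
by rewrite !eqxx => /eqP; rewrite oner_eq0.
Qed.

Lemma idem_lE1 x a u v : (Didem x * a).1 u v = (u == x)%:R * a.1 u v.
Proof. by rewrite DM1 finitaryME iconv_ideml. Qed.

Lemma idem_rE1 x a u v : (a * Didem x).1 u v = a.1 u v * (v == x)%:R.
Proof. by rewrite DM1 finitaryME iconv_idemr. Qed.

Lemma idem_lE2 x a u v : (Didem x * a).2 u v = (u == x)%:R * a.2 u v.
Proof. by rewrite DM2 iconv_zerol addr0 iconv_ideml. Qed.

Lemma idem_rE2 x a u v : (a * Didem x).2 u v = a.2 u v * (v == x)%:R.
Proof. by rewrite DM2 iconv_zeror add0r iconv_idemr. Qed.

Lemma fi_unit_incidence x y :
  (fun u v : X => [&& u == x, v == y & (x <= y)%O]%:R) \in incidence_pred X K.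
Proof.
apply/asboolP => u v; case: eqVneq => // ->; case: eqVneq => //= ->.
by case: (x <= y)%O.
Qed.

Lemma fi_unit_finitary x y :
  Incidence (fi_unit_incidence x y) \in finitary_pred X K.
Proof.
apply/asboolP => a b _; apply: (@sub_finite_set _ _ [set (x, y)]%classic).
  move=> [u v] [/= _ _ _]; case: (eqVneq u x) => [->|]; rewrite ?eqxx//.
  by case: (eqVneq v y) => [->|]; rewrite ?eqxx.
exact: finite_set1.
Qed.

(** The matrix unit [e_xy]; it is zero unless [x <= y]. *)
Definition fi_unit x y : finitary X K := Finitary (fi_unit_finitary x y).

Lemma fi_unitxx x : fi_unit x x = fi_idem x.
Proof. by apply: finitary_ext => u v /=; rewrite lexx andbT. Qed.

Lemma fi_unitE x y u v : (x <= y)%O ->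
  fi_unit x y u v = (u == x)%:R * (v == y)%:R.
Proof. by move=> xy /=; rewrite xy andbT -natrM mulnb. Qed.

Lemma fi_unit_neq0 x y u v : (x <= y)%O -> fi_unit x y u v != 0 :> K -> u = x /\ v = y.
Proof.
move=> xy; rewrite fi_unitE//.
by case: (eqVneq u x) => [->|]; case: (eqVneq v y) => [->|]; rewrite ?mul0r ?mulr0 ?eqxx.
Qed.

Lemma fi_unit_entry x y : (x <= y)%O -> fi_unit x y x y = 1 :> K.
Proof. by move=> xy; rewrite fi_unitE// !eqxx mulr1. Qed.

Lemma iconv_unitl x y i z : (x <= y)%O -> iconv (fi_unit x y) i x z = i y z.
Proof.
move=> xy; rewrite (@iconv_single _ _ _ y) ?fi_unitE// ?eqxx ?mul1r// => w.
by rewrite fi_unitE// eqxx mul1r; case: (eqVneq w y) => //; rewrite eqxx.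
Qed.

(** The corner [e_x D e_y] is spanned by the two copies of the matrix unit. *)
Lemma D_sandwich a x y : Didem x * a * Didem y =
  a.1 x y *: Dfi (fi_unit x y) + a.2 x y *: Dinc (fi_unit x y).
Proof.
have [xy|xy] := boolP (x <= y)%O.
  apply: D_eq => u v.
    rewrite idem_rE1 idem_lE1.
    have -> : (a.1 x y *: Dfi (fi_unit x y) + a.2 x y *: Dinc (fi_unit x y)).1 u v
      = a.1 x y * fi_unit x y u v + a.2 x y * 0 by [].
    rewrite fi_unitE// mulr0 addr0.
    by case: eqVneq => [->|]; case: eqVneq => [->|]; rewrite ?mul1r ?mul0r ?mulr0 ?mulr1.
  rewrite idem_rE2 idem_lE2.
  have -> : (a.1 x y *: Dfi (fi_unit x y) + a.2 x y *: Dinc (fi_unit x y)).2 u v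
    = a.1 x y * 0 + a.2 x y * fi_unit x y u v by [].
  rewrite fi_unitE// mulr0 add0r.
  by case: eqVneq => [->|]; case: eqVneq => [->|]; rewrite ?mul1r ?mul0r ?mulr0 ?mulr1.
rewrite [a.1 x y]incidence_out// [a.2 x y]incidence_out// !scale0r addr0.
apply: D_eq => u v.
  rewrite idem_rE1 idem_lE1; case: eqVneq => [->|]; last by rewrite !mul0r.
  by case: eqVneq => [->|]; rewrite ?mulr0// [a.1 x y]incidence_out// mulr0 mul0r.
rewrite idem_rE2 idem_lE2; case: eqVneq => [->|]; last by rewrite !mul0r.
by case: eqVneq => [->|]; rewrite ?mulr0// [a.2 x y]incidence_out// mulr0 mul0r.
Qed.

End Entries.

(** * Units and idempotents *)

Section Units.
Context {d : Order.disp_t} {X : porderType d} {K : fieldType}.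
Implicit Types (i j : incidence X K) (f g n : finitary X K) (a b : Dalg X K).
Implicit Types (x y z : X).

(** Finitarity is a condition on each interval separately. *)
Lemma finitary_local i :
  (forall x y, exists f, forall u v, (x <= u)%O -> (v <= y)%O -> i u v = f u v) ->
  i \in finitary_pred X K.
Proof.
move=> h; apply/asboolP => x y _; have [f fi] := h x y.
apply: sub_finite_set (finitary_fin f x y) => -[u v] [/= xu uv vy iuv].
by split=> //=; rewrite -fi.
Qed.

(** An entry at [(x, y)] of a product depends only on the entries of the right
    factor at points of the interval. *)
Lemma iconv_local f i j x y :
  (forall z, (x <= z)%O -> (z <= y)%O -> i z y = j z y) ->
  iconv f i x y = iconv f j x y.
Proof.
move=> h; apply: eq_fsbigr => z; rewrite inE /= => /andP[xz zy].
by rewrite h.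
Qed.

Lemma sum_entry M (F : nat -> finitary X K) x y :
  (\sum_(k < M) F k) x y = \sum_(k < M) F k x y.
Proof. by elim/big_rec2: _ => // k s f _ <-. Qed.

(** A nonzero entry of the [k]-th power of a strictly upper triangular element
    comes from a chain of length [k] through the finitely many nodes of [n]. *)
Lemma strict_locally_nilpotent n x y : (forall z, n z z = 0) ->
  exists M, forall k u v, (M <= k)%N -> (x <= u)%O -> (v <= y)%O ->
    (n ^+ k) u v = 0.
Proof.
move=> n0; have [r [xr yr hr]] := finitary_nodes n x y.
suff key k u v : (x <= u)%O -> (v <= y)%O -> (n ^+ k) u v != 0 ->
    (k <= count (fun z => (u < z)%O && (z <= v)%O) r)%N.
  exists (size r).+1 => k u v Mk xu vy; apply/eqP; apply: contraTT Mk => nk.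
  by rewrite -ltnNge ltnS; apply: leq_trans (key _ _ _ xu vy nk) (count_size _ _).
elim: k u v => // k IH u v xu vy; rewrite exprS => /iconv_neq0[z [uz zv nuz nkzv]].
have {}uz : (u < z)%O.
  by rewrite lt_neqAle uz andbT; apply: contraNneq nuz => ->; rewrite n0.
have [_ zr] := hr _ _ xu (le_trans zv vy) uz nuz.
apply: leq_ltn_trans (IH z v (le_trans xu (ltW uz)) vy nkzv) _.
rewrite [X in (_ < X)%N](@eq_count _ _ (predU
    (fun w => (z < w)%O && (w <= v)%O)
    (fun w => (u < w)%O && (w <= v)%O && ~~ (z < w)%O))); last first.
  move=> w /=; case zw: (z < w)%O => /=; last by rewrite andbT.
  by rewrite (lt_trans uz zw) andbF orbF.
have := count_predUI (fun w => (z < w)%O && (w <= v)%O)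
  (fun w => (u < w)%O && (w <= v)%O && ~~ (z < w)%O) r.
rewrite [X in (_ + X)%N = _ -> _](@eq_count _ _ pred0); last first.
  by move=> w /=; case: (z < w)%O; rewrite /= ?andbF.
rewrite count_pred0 addn0 => ->.
rewrite -addn1 leq_add2l -has_count; apply/hasP; exists z => //=.
by rewrite uz zv ltxx.
Qed.

Lemma geometric_finitary M n : (1 - n) * (\sum_(k < M) n ^+ k) = 1 - n ^+ M.
Proof. by rewrite -[1 - n]opprB mulNr -subrX1 opprB. Qed.

(** The geometric series is summed on each interval up to the order of
    nilpotency there, so the inverse is locally finitary. *)
Lemma strict_right_inverse n : (forall z, n z z = 0) ->
  exists g, (1 - n) * g = 1.
Proof.
move=> n0.
have /choice[N hN] : forall p : X * X, exists M, forall k u v, (M <= k)%N ->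
    (p.1 <= u)%O -> (v <= p.2)%O -> (n ^+ k) u v = 0.
  by move=> p; exact: strict_locally_nilpotent.
pose G M : finitary X K := \sum_(k < M) n ^+ k.
have GE M x y u v : (N (x, y) <= M)%N -> (x <= u)%O -> (v <= y)%O ->
    G M u v = G (N (x, y)) u v.
  move=> NM xu vy; rewrite /G !sum_entry.
  rewrite [RHS](big_ord_widen M (fun k => (n ^+ k) u v) NM) [RHS]big_mkcond.
  apply: eq_bigr => k _; case: ltnP => // Nk.
  exact: (hN (x, y)).
have gin : (fun x y => G (N (x, y)) x y) \in incidence_pred X K.
  by apply/asboolP => x y xy; rewrite incidence_out.
pose g0 := Incidence gin.
have g0E x y u v : (x <= u)%O -> (v <= y)%O -> g0 u v = G (N (x, y)) u v.
  move=> xu vy /=.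
  rewrite -(@GE (maxn (N (x, y)) (N (u, v))) x y u v) ?leq_maxl//.
  by rewrite -(@GE (maxn (N (x, y)) (N (u, v))) u v u v) ?leq_maxr.
have gfin : g0 \in finitary_pred X K.
  by apply: finitary_local => x y; exists (G (N (x, y))) => u v; exact: g0E.
exists (Finitary gfin); apply: finitary_ext => x y; rewrite finitaryME.
rewrite (@iconv_local _ _ (G (N (x, y)))) => [|z xz zy]; last first.
  by rewrite /= -[LHS]/(g0 z y) (g0E x y).
rewrite -finitaryME geometric_finitary.
have -> : (1 - n ^+ N (x, y)) x y = (1 : finitary X K) x y - (n ^+ N (x, y)) x y by [].
by rewrite (hN (x, y)) ?subr0.
Qed.

(** An element of [FI(X,K)] is a unit as soon as its diagonal entries are
    nonzero: after rescaling it is [1 - n] with [n] strictly upper triangular. *)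
Lemma fi_invertible_diag f : (forall x, f x x != 0) -> exists g, f * g = 1 /\ g * f = 1.
Proof.
have right f' : (forall x, f' x x != 0) -> exists g, f' * g = 1.
  move=> f'0; pose h := fi_diag (fun x => (f' x x)^-1) : finitary X K.
  have [x|g] := @strict_right_inverse (1 - h * f').
    have -> : (1 - h * f') x x = (1 : finitary X K) x x - iconv h f' x x by [].
    by rewrite iconv_diagl mulVf//= eqxx subrr.
  rewrite opprB addrC subrK => hfg.
  exists (g * h).
  have h'h : fi_diag (fun x => f' x x) * h = 1.
    rewrite fi_diagM -fi_diag1; congr fi_diag.
    by apply/funext => x; rewrite divff.
  have hh' : h * fi_diag (fun x => f' x x) = 1.
    rewrite fi_diagM -fi_diag1; congr fi_diag.
    by apply/funext => x; rewrite mulVf.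
  have -> : f' = fi_diag (fun x => f' x x) * (h * f') by rewrite mulrA h'h mul1r.
  by rewrite mulrA -(mulrA _ _ g) hfg mulr1.
move=> f0; have [g fg] := right f f0.
have [|g' gg'] := right g.
  move=> x; have /(congr1 (fun f : finitary X K => f x x)) := fg.
  rewrite finitaryME iconv_diag /= eqxx => e; apply/eqP => g0.
  by move: e; rewrite g0 mulr0 => /esym/eqP; rewrite oner_eq0.
exists g; split=> //.
suff -> : f = g' by [].
by rewrite -[f]mulr1 -gg' mulrA fg mul1r.
Qed.

(** The [I(X,K)] component plays no role, being a square-zero ideal. *)
Lemma D_invertible_diag a : (forall x, a.1 x x != 0) ->
  exists b, a * b = 1 /\ b * a = 1.
Proof.
move=> /fi_invertible_diag[g [fg gf]].
exists (g, - iconv (iconv g a.2) g); split; apply: D_ext => //.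
  rewrite DM2 /= iconvNr -iconvA_fif !iconvA_ffi -finitaryME fg.
  by rewrite iconv1l addrC subrr.
rewrite DM2 /= iconvNl -iconvA_iff -finitaryME gf iconv1r subrr//.
Qed.

Lemma D_idem_conj_diag a : a * a = a ->
  ring_conjugate a (Dfi (fi_diag (fun x => a.1 x x))).
Proof.
move=> aa; pose e := Dfi (fi_diag (fun x => a.1 x x)).
have adiag x : a.1 x x * a.1 x x = a.1 x x by rewrite -D1_diag aa.
have ee : e * e = e.
  rewrite /e DfiM fi_diagM; congr (Dfi (fi_diag _)).
  by apply/funext => x.
have e1 x : e.1 x x = a.1 x x by rewrite /= eqxx mul1r.
(* The classical conjugating element of two idempotents with the same image
   modulo the radical. *)
pose u := e * a + (1 - e) * (1 - a).
have [x|v [uv vu]] := @D_invertible_diag u.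
  have -> : u.1 x x = (e * a).1 x x + ((1 - e) * (1 - a)).1 x x by [].
  rewrite !D1_diag.
  have eC b : (1 - b).1 x x = 1 - b.1 x x.
    have -> : (1 - b).1 x x = (1 : finitary X K) x x - b.1 x x by [].
    by rewrite /= eqxx.
  rewrite !eC !e1; have := adiag x.
  move: (a.1 x x) => t; have [->|t0] := eqVneq t 0.
    by rewrite mulr0 add0r subr0 mulr1 oner_neq0.
  move=> /eqP; rewrite -subr_eq0 -[X in _ - X]mulr1 -mulrBr mulf_eq0 (negbTE t0) /=.
  by rewrite subr_eq0 => /eqP ->; rewrite subrr mulr0 addr0 mulr1 oner_neq0.
exists u, v; split=> //.
suff ue : u * a = e * u by rewrite ue -mulrA uv mulr1.
have -> : u * a = e * a.
  by rewrite /u mulrDl -!mulrA aa (mulrBl a 1 a) mul1r aa subrr mulr0 addr0.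
by rewrite /u mulrDr !mulrA ee (mulrBr e 1 e) mulr1 ee subrr mul0r addr0.
Qed.

End Units.

(** * A finiteness principle for relations *)

Section Finiteness.
Context {d : Order.disp_t} {X : porderType d}.
Local Open Scope classical_set_scope.

Lemma injective_seq_infinite (T : Type) (f : nat -> T) (A : set T) :
  injective f -> (forall n, A (f n)) -> ~ finite_set A.
Proof.
move=> fI fA Afin; apply: infinite_nat.
rewrite -(eq_finite_set (inj_card_eq (in2W fI))).
by apply: sub_finite_set Afin => _ [n _ <-].
Qed.

(* In the application S a b (resp. T a b) says that the idempotent indexed by b
   (resp. by a) has a nonzero entry at (a, b). *)
Variables S T : X -> X -> Prop.
Hypothesis S_lt : forall a b, S a b -> (a < b)%O.
Hypothesis T_lt : forall a b, T a b -> (a < b)%O.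
Hypothesis S_sources : forall B : set X,
  finite_set [set a | ~ B a /\ exists2 b, B b & S a b].
Hypothesis T_targets : forall A : set X,
  finite_set [set b | ~ A b /\ exists2 a, A a & T a b].
Hypothesis S_split : forall a b, S a b -> T a b \/ exists2 c, T a c & S c b.

(** If some [a] had infinitely many [S]-successors, then so would one of its
    finitely many [T]-successors; iterating gives an infinite [T]-chain, whose
    terms of even rank contradict [T_targets]. *)
Lemma finite_S_targets a : finite_set [set b | S a b].
Proof.
apply: contrapT => Sa; pose P := [set a | ~ finite_set [set b | S a b]].
have step (p : {a | P a}) : exists q : {a | P a}, T (sval p) (sval q).
  case: p => {Sa}a Pa /=; apply: contrapT => nq; apply: Pa.
  have Tfin : finite_set [set c | T a c].
    apply: sub_finite_set (T_targets [set a]) => c /= Tac.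
    by split; [move=> ca; move: (T_lt Tac); rewrite ca ltxx|exists a].
  apply: (@sub_finite_set _ _ ([set c | T a c] `|`
      \bigcup_(c in [set c | T a c]) [set b | S c b])).
    by move=> b /S_split[Tab|[c Tac Scb]]; [left|right; exists c].
  rewrite finite_setU; split=> //; apply: bigcup_finite => // c Tac.
  by apply: contrapT => Pc; apply: nq; exists (exist _ c Pc).
have [g gT] := choice step.
pose s n := sval (iter n g (exist _ a Sa)).
have sT n : T (s n) (s n.+1) by exact: gT.
have s_lt : {homo s : m n / (m < n)%N >-> (m < n)%O}.
  by apply: Order.NatMonotonyTheory.homo_ltn_lt => n; exact/T_lt/sT.
have sI : injective s.
  move=> m n smn; case: (ltngtP m n) => // /s_lt; first by rewrite smn ltxx.
  by rewrite smn ltxx.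
apply: (@injective_seq_infinite _ (fun n => s n.*2.+1) _ _ _
  (T_targets [set s n.*2 | n in setT])).
  by move=> m n /sI/eqP; rewrite eqSS => /eqP/double_inj.
move=> n; split; last by exists (s n.*2) => //; exists n.
by move=> [m _ /sI/(congr1 odd)]; rewrite /= !odd_double.
Qed.

(** An infinite [S] with finite fibres on both sides contains an infinite
    matching with disjoint sets of sources and targets, found greedily; the
    set of its targets then contradicts [S_sources]. *)
Lemma finite_S : finite_set [set p : X * X | S p.1 p.2].
Proof.
apply: contrapT => Sinf.
have src b : finite_set [set a | S a b].
  apply: sub_finite_set (S_sources [set b]) => a /= Sab.
  by split; [move=> ab; move: (S_lt Sab); rewrite ab ltxx|exists b].
(* A finite set of points meets only finitely many pairs of S. *)
have step (s : seq X) : exists p : X * X,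
    [/\ S p.1 p.2, p.1 \notin s & p.2 \notin s].
  apply: contrapT => np; apply: Sinf.
  apply: (@sub_finite_set _ _ (\bigcup_(v in [set` s])
    ((pair v @` [set b | S v b]) `|` ((fun a => (a, v)) @` [set a | S a v])))).
    move=> [a b] /= Sab; have [sa|sa] := boolP (a \in s).
      by exists a => //; left; exists b.
    have [sb|sb] := boolP (b \in s); first by exists b => //; right; exists a.
    by case: np; exists (a, b).
  apply: bigcup_finite; first exact: finite_seq.
  move=> v _; rewrite finite_setU; split; apply: finite_image => //.
  exact: finite_S_targets.
have [pick pickP] := choice step.
pose used n := iter n (fun s => (pick s).1 :: (pick s).2 :: s) [::].
pose p n := pick (used n).
have pS n : S (p n).1 (p n).2 by case: (pickP (used n)).
have used_lt m n : (m < n)%N -> (p m).1 \in used n /\ (p m).2 \in used n.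
  elim: n => // n IH; rewrite ltnS leq_eqVlt => /predU1P[->|/IH[h1 h2]].
    by rewrite /= !inE !eqxx orbT.
  by rewrite /= !inE h1 h2 !orbT.
apply: (@injective_seq_infinite _ (fun n => (p n).1) _ _ _
  (S_sources [set (p n).2 | n in setT])).
  have key m n : (m < n)%N -> (p m).1 <> (p n).1.
    move=> /used_lt[pm _] e; have [_ + _] := pickP (used n).
    by rewrite -/(p n) -e pm.
  by move=> m n; case: (ltngtP m n) => // /key h; [move/h|move/esym/h].
move=> n; split; last by exists (p n).2 => //; exists n.
move=> [m _]; case: (ltngtP m n) => [/used_lt[_ pm] e|nm e|-> e].
- by have [_ + _] := pickP (used n); rewrite -/(p n) -e pm.
- have [pn _] := used_lt _ _ nm.
  by have [_ _] := pickP (used m); rewrite -/(p m) e pn.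
- by move: (S_lt (pS n)); rewrite e ltxx.
Qed.

End Finiteness.

(** * Simultaneous conjugation of the idempotents *)

Section Conjugation.
Context {d : Order.disp_t} {X : porderType d} {K : fieldType}.
Implicit Types (i j : incidence X K) (f g n : finitary X K) (a b : Dalg X K).
Implicit Types (x y z : X).
Local Open Scope classical_set_scope.

Lemma ring_conjugate_sym (R : pzRingType) (a b : R) :
  ring_conjugate a b -> ring_conjugate b a.
Proof.
move=> [u [v [uv vu ->]]]; exists v, u; split=> //.
by rewrite !mulrA vu mul1r -mulrA vu mulr1.
Qed.

Lemma ring_conjugate_trans (R : pzRingType) (a b c : R) :
  ring_conjugate a b -> ring_conjugate b c -> ring_conjugate a c.
Proof.
move=> [u [v [uv vu ->]]] [w [t [wt tw ->]]]; exists (w * u), (v * t).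
split; last by rewrite !mulrA.
  by rewrite mulrA -(mulrA w) uv mulr1.
by rewrite mulrA -(mulrA v) tw mulr1.
Qed.

Lemma conj_diag a b x : ring_conjugate a b -> a.1 x x = b.1 x x.
Proof.
move=> [u [v [uv _ ->]]]; rewrite !D1_diag [_ * a.1 x x]mulrC -mulrA -D1_diag uv.
by rewrite /= eqxx mulr1.
Qed.

Lemma D_col_eq a b : (forall x, a * Didem x = b * Didem x) -> a = b.
Proof.
move=> h; apply: D_eq => u v.
  have /(congr1 (fun a : Dalg X K => a.1 u v)) := h v.
  by rewrite !idem_rE1 eqxx !mulr1.
have /(congr1 (fun a : Dalg X K => a.2 u v)) := h v.
by rewrite !idem_rE2 eqxx !mulr1.
Qed.

Variable phi : Dalg X K -> Dalg X K.
Hypothesis phiM : forall a b, phi (a * b) = phi a * phi b.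
Hypothesis phi0 : phi 0 = 0.
Hypothesis phi_conj : forall x, ring_conjugate (phi (Didem x)) (Didem x).

(* The finitary part of the idempotent phi e_x. *)
Let p x : finitary X K := (phi (Didem x)).1.

Lemma conj_idem_diag x y : p x y y = (y == x)%:R.
Proof. by rewrite /p (conj_diag _ (phi_conj x)) /= andbb. Qed.

Lemma conj_set_diag (A : X -> bool) x : (phi (Dset A)).1 x x = (A x)%:R.
Proof.
have : Dset A * Didem x = if A x then Didem x else 0 :> Dalg X K.
  rewrite DidemE DsetM; case: ifPn => Ax.
    by apply: eq_Dset => y; case: eqVneq => [->|]; rewrite ?andbT ?andbF.
  apply: D_eq => u v //=; case: (eqVneq u x) => [->|].
    by rewrite (negbTE Ax) mulr0.
  by rewrite andbF mulr0.
move/(congr1 (fun a => (phi a).1 x x)); rewrite phiM D1_diag.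
rewrite (_ : (phi (Didem x)).1 x x = 1) ?mulr1 => [->|].
  case: ifP => _; first by rewrite -/(p x) conj_idem_diag eqxx.
  by rewrite phi0.
by rewrite -/(p x) conj_idem_diag eqxx.
Qed.

Lemma idem_cols_finitary_sub :
  (fun x y => p y x y) \in incidence_pred X K.
Proof. by apply/asboolP => x y xy; rewrite incidence_out. Qed.

(** Finiteness is obtained by evaluating [phi] at the idempotents of arbitrary
    subsets of [X]. *)
Lemma idem_cols_finitary :
  Incidence idem_cols_finitary_sub \in finitary_pred X K.
Proof.
apply/asboolP => x y _.
pose S (a b : X) := [/\ (x <= a)%O, (a < b)%O, (b <= y)%O & p b a b != 0].
pose T (a b : X) := [/\ (x <= a)%O, (a < b)%O, (b <= y)%O & p a a b != 0].
apply: (@sub_finite_set _ _ [set q : X * X | S q.1 q.2]); first by move=> [a b] [].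
apply: (@finite_S _ _ S T).
- by move=> a b [].
- by move=> a b [].
(* If a is not in B and p b is nonzero at (a, b) with b in B, then
   phi(e_B) p b = p b forces a nonzero strict entry of phi(e_B) in row a. *)
- move=> B; pose g := (phi (Dset (fun x => `[< B x >]))).1.
  apply: sub_finite_set (finite_image fst (finitary_fin g x y)) => a [/= nBa].
  move=> [b Bb [xa ab by_ pab]].
  have gp : g * p b = p b.
    rewrite /g /p -DM1 -phiM DidemE DsetM; congr ((phi _).1); apply: eq_Dset => u.
    by case: eqVneq => [->|]; rewrite ?andbF// andbT; apply/asboolP.
  have [c ac [cb gac]] : exists2 c, (a < c)%O & (c <= b)%O /\ g a c != 0.
    apply: contrapT => nc; move: pab; rewrite -gp finitaryME.
    rewrite (@iconv_single _ _ _ _ _ _ a) => [|w gaw pwb].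
      by rewrite conj_set_diag; case: asboolP => // _; rewrite mul0r eqxx.
    have := incidence_neq0 gaw; rewrite le_eqVlt => /predU1P[//|aw].
    by case: nc; exists w => //; split=> //; exact: incidence_neq0 pwb.
  by exists (a, c) => //; split=> //=; exact: le_trans by_.
- move=> A; pose g := (phi (Dset (fun x => `[< A x >]))).1.
  apply: sub_finite_set (finite_image snd (finitary_fin g x y)) => b [/= nAb].
  move=> [a Aa [xa ab by_ pab]].
  have pg : p a * g = p a.
    rewrite /g /p -DM1 -phiM DidemE DsetM; congr ((phi _).1); apply: eq_Dset => u.
    by case: eqVneq => [->|]; rewrite ?andbF//; apply/asboolP.
  have [c cb [ac gcb]] : exists2 c, (c < b)%O & (a <= c)%O /\ g c b != 0.
    apply: contrapT => nc; move: pab; rewrite -pg finitaryME.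
    rewrite (@iconv_single _ _ _ _ _ _ b) => [|w paw gwb].
      by rewrite conj_set_diag; case: asboolP => // _; rewrite mulr0 eqxx.
    have := incidence_neq0 gwb; rewrite le_eqVlt => /predU1P[//|wb].
    by case: nc; exists w => //; split=> //; exact: incidence_neq0 paw.
  by exists (c, b) => //; split=> //=; exact: le_trans ac.
(* The entry of p a * p b at (a, b) vanishes, so that p b a b is cancelled by
   other terms. *)
move=> a b [xa ab by_ pab]; apply: contrapT => /not_orP[nT nTS].
have pp : p a * p b = 0.
  by rewrite /p -DM1 -phiM Didem_orth ?phi0// lt_eqF.
have : (p a * p b) a b = 0 by rewrite pp.
rewrite finitaryME (@iconv_single _ _ _ _ _ _ a) => [|w paw pwb].
  by rewrite conj_idem_diag eqxx mul1r => pab0; rewrite pab0 eqxx in pab.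
have aw := incidence_neq0 paw; have wb := incidence_neq0 pwb.
move: (aw) (wb); rewrite !le_eqVlt => /predU1P[//|aw'] /predU1P[e|wb'].
  by case: nT; rewrite -e; split=> //; rewrite e.
case: nTS; exists w; split=> //; first exact: le_trans by_.
exact: le_trans xa aw.
Qed.

Lemma idem_cols_incidence :
  (fun x y => (phi (Didem y)).2 x y) \in incidence_pred X K.
Proof. by apply/asboolP => x y xy; rewrite incidence_out. Qed.

(** The conjugating unit is the element whose column of index [x] is that of
    [phi (Didem x)]. *)
Lemma simultaneous_conj : exists u v : Dalg X K, [/\ u * v = 1, v * u = 1 &
  forall x, phi (Didem x) = u * Didem x * v].
Proof.
pose u : Dalg X K := (Finitary idem_cols_finitary, Incidence idem_cols_incidence).
have ucol x : u * Didem x = phi (Didem x) * Didem x.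
  apply: D_eq => s t.
    by rewrite !idem_rE1 /=; case: eqVneq => [->|]; rewrite ?mulr0.
  by rewrite !idem_rE2 /=; case: eqVneq => [->|]; rewrite ?mulr0.
have [x|v [uv vu]] := @D_invertible_diag _ _ _ u.
  by rewrite /= conj_idem_diag eqxx oner_neq0.
exists u, v; split=> // x.
suff -> : u * Didem x = phi (Didem x) * u by rewrite -mulrA uv mulr1.
apply: D_col_eq => y; rewrite -[RHS]mulrA !ucol [RHS]mulrA -phiM -[LHS]mulrA.
have [->|xy] := eqVneq x y; first by rewrite !Didem_idem.
by rewrite Didem_orth// phi0 mul0r mulr0.
Qed.

End Conjugation.

(** * Automorphisms fixing the diagonal idempotents *)

Section Cocycles.
Context {d : Order.disp_t} {X : porderType d} {K : fieldType}.
Implicit Types (s t i : incidence X K) (f g : finitary X K).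
Implicit Types (x y z : X).

Lemma fi_idem_diag f : (forall x, f * fi_idem x = fi_idem x * f) ->
  f = fi_diag (fun x => f x x).
Proof.
move=> h; apply: finitary_ext => x y /=.
have /(congr1 (fun f : finitary X K => f x y)) := h y.
rewrite !finitaryME iconv_ideml iconv_idemr eqxx mulr1 => ->.
by case: eqVneq => [->|]; rewrite ?mul0r// mul0r.
Qed.

Lemma mult_cocycle_diag s x : mult_cocycle s -> s x x = 1.
Proof.
move=> [s0 sM]; apply: (mulfI (s0 x x (lexx x))).
by rewrite mulr1; exact: sM.
Qed.

(** A unit implementing a multiplicative automorphism is diagonal, hence acts
    in the same way on all of [I(X,K)]. *)
Lemma mult_inner_hadamard s : mult_cocycle s -> inner_automorphism (mult_map s) ->
  exists f g, [/\ f * g = 1, g * f = 1 & forall i, hadamard s i = iconv (iconv f i) g].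
Proof.
move=> sC [f [g [fg gf h]]]; exists f, g; split=> // i.
have e x : fi_idem x = f * fi_idem x * g.
  rewrite -h; apply: finitary_ext => u v /=.
  case: (eqVneq u x) => [->|]; last by rewrite mulr0.
  case: (eqVneq v x) => [->|]; last by rewrite mulr0.
  by rewrite mult_cocycle_diag// mul1r.
have fE j x y : iconv f j x y = f x x * j x y.
  rewrite {1}(@fi_idem_diag f) ?iconv_diagl// => z.
  by rewrite [in RHS](e z) -[RHS]mulrA gf mulr1.
have gE j x y : iconv j g x y = j x y * g y y.
  rewrite {1}(@fi_idem_diag g) ?iconv_diagr// => z.
  by rewrite [in LHS](e z) !mulrA gf mul1r.
apply: incidence_ext => x y.
have [xy|xy] := boolP (x <= y)%O; last by rewrite !incidence_out.
have := congr1 (fun k : finitary X K => k x y) (h (fi_unit x y)).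
rewrite -[LHS]/(s x y * fi_unit x y x y) !finitaryME gE fE fi_unitE//.
by rewrite !eqxx !mulr1 gE fE /= => ->; rewrite mulrAC.
Qed.

Lemma add_cocycle_derivation t :
  (forall x y z, (x <= y)%O -> (y <= z)%O -> t x z = t x y + t y z) ->
  fi_derivation (hadamard t : finitary X K -> incidence X K).
Proof.
move=> tA; split.
  move=> c f g; apply: incidence_ext => x y.
  have -> : hadamard t (c *: f + g) x y = t x y * (c * f x y + g x y) by [].
  rewrite incidenceD incidenceZ /=; ring.
move=> f g; apply: incidence_ext => x y.
have [r [ur xr yr hr]] := finitary_nodes2 f f x y.
have hf z : f x z != 0 -> (z <= y)%O -> z \in r.
  by move=> fz zy; apply: (nodes_r zy xr _ fz) => u v xu vy uv n; apply: hr => //; left.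
rewrite incidenceD -[LHS]/(t x y * iconv f g x y).
rewrite !(@iconvE _ _ _ _ _ r)//.
- rewrite mulr_sumr -big_split; apply: eq_bigr => z _ /=.
  have [->|fz] := eqVneq (f x z) 0; first by ring.
  have [->|gz] := eqVneq (g z y) 0; first by ring.
  by rewrite (tA x z y) ?(incidence_neq0 fz) ?(incidence_neq0 gz)//; ring.
- by move=> z fz /incidence_neq0; exact: hf.
- move=> z; rewrite /= mulf_eq0 negb_or => /andP[_ fz] /incidence_neq0; exact: hf.
- by move=> z fz /incidence_neq0; exact: hf.
Qed.

End Cocycles.

Lemma linear_map0 (K : fieldType) (U V : lmodType K) (h : U -> V) :
  linear h -> h 0 = 0.
Proof. by move=> /(_ (-1) 0 0); rewrite scaler0 addr0 scaleN1r addNr. Qed.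

Lemma linear_comb (K : fieldType) (U V : lmodType K) (h : U -> V) k l u v :
  linear h -> h (k *: u + l *: v) = k *: h u + l *: h v.
Proof.
move=> hL; rewrite hL; congr (_ + _).
by have := hL l v 0; rewrite !addr0 linear_map0// addr0.
Qed.

Section NormalForm.
Context {d : Order.disp_t} {X : porderType d} {K : fieldType}.
Implicit Types (i j : incidence X K) (f g : finitary X K) (a b : Dalg X K).
Implicit Types (x y z : X).

Variable phi : Dalg X K -> Dalg X K.
Hypothesis phiL : linear phi.
Hypothesis phiM : forall a b, phi (a * b) = phi a * phi b.
Hypothesis phi_surj : forall b, exists a, phi a = b.
Hypothesis phi_idem : forall x, phi (Didem x) = Didem x.

Let U x y : Dalg X K := Dfi (fi_unit x y).
Let V x y : Dalg X K := Dinc (fi_unit x y).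

Lemma entry_incidence1 (a : X -> X -> Dalg X K) :
  (fun x y => (a x y).1 x y) \in incidence_pred X K.
Proof. by apply/asboolP => x y xy; rewrite incidence_out. Qed.

Lemma entry_incidence2 (a : X -> X -> Dalg X K) :
  (fun x y => (a x y).2 x y) \in incidence_pred X K.
Proof. by apply/asboolP => x y xy; rewrite incidence_out. Qed.

(* The entries at (x, y) of the images of the matrix units at (x, y): [s], [t]
   are those of the image of [U x y], and [m], [n] those of [V x y]. *)
Let s : incidence X K := Incidence (entry_incidence1 (fun x y => phi (U x y))).
Let t : incidence X K := Incidence (entry_incidence2 (fun x y => phi (U x y))).
Let m : incidence X K := Incidence (entry_incidence1 (fun x y => phi (V x y))).
Let n : incidence X K := Incidence (entry_incidence2 (fun x y => phi (V x y))).

Lemma phi_sandwich a x y :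
  Didem x * phi a * Didem y = a.1 x y *: phi (U x y) + a.2 x y *: phi (V x y).
Proof.
by rewrite -[in LHS](phi_idem x) -[in LHS](phi_idem y) -!phiM D_sandwich linear_comb.
Qed.

Lemma phi_entry1 a x y : (phi a).1 x y = a.1 x y * s x y + a.2 x y * m x y.
Proof.
have /(congr1 (fun b : Dalg X K => b.1 x y)) := phi_sandwich a x y.
by rewrite idem_rE1 idem_lE1 !eqxx mul1r mulr1.
Qed.

Lemma phi_entry2 a x y : (phi a).2 x y = a.1 x y * t x y + a.2 x y * n x y.
Proof.
have /(congr1 (fun b : Dalg X K => b.2 x y)) := phi_sandwich a x y.
by rewrite idem_rE2 idem_lE2 !eqxx mul1r mulr1.
Qed.

(* Row x of phi (U x y) is concentrated at y, which turns multiplicativity of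
   phi on products U x y * b into scalar relations between s, t, m and n. *)
Lemma phi_unit_row1 x y b z : (x <= y)%O ->
  (phi (U x y * b)).1 x z = s x y * (phi b).1 y z.
Proof.
move=> xy; rewrite phiM DM1 finitaryME (@iconv_single _ _ _ _ _ _ y)// => w.
rewrite phi_entry1 /= mul0r addr0 mulf_eq0 negb_or => /andP[+ _] _.
by move=> /(fi_unit_neq0 xy)[].
Qed.

Lemma phi_unit_row2 x y b z : (x <= y)%O ->
  (phi (U x y * b)).2 x z = s x y * (phi b).2 y z + t x y * (phi b).1 y z.
Proof.
move=> xy; rewrite phiM DM2 incidenceD.
rewrite !(@iconv_single _ _ _ _ _ _ y)// => w.
  rewrite phi_entry2 /= mul0r addr0 mulf_eq0 negb_or => /andP[+ _] _.
  by move=> /(fi_unit_neq0 xy)[].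
rewrite phi_entry1 /= mul0r addr0 mulf_eq0 negb_or => /andP[+ _] _.
by move=> /(fi_unit_neq0 xy)[].
Qed.

Lemma unit_rel1 x y z b : (x <= y)%O ->
  b.1 y z * s x z + b.2 y z * m x z = s x y * (b.1 y z * s y z + b.2 y z * m y z).
Proof.
move=> xy; rewrite -!phi_entry1 -phi_unit_row1// phi_entry1.
rewrite DM1 DM2 finitaryME incidenceD iconv_unitl// iconv_unitl//.
by rewrite iconv_zerol addr0.
Qed.

Lemma unit_rel2 x y z b : (x <= y)%O ->
  b.1 y z * t x z + b.2 y z * n x z =
  s x y * (b.1 y z * t y z + b.2 y z * n y z) +
  t x y * (b.1 y z * s y z + b.2 y z * m y z).
Proof.
move=> xy; rewrite -!phi_entry2 -!phi_entry1 -phi_unit_row2// phi_entry2.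
rewrite DM1 DM2 finitaryME incidenceD iconv_unitl// iconv_unitl//.
by rewrite iconv_zerol addr0.
Qed.

Lemma s_mul x y z : (x <= y)%O -> (y <= z)%O -> s x y * s y z = s x z.
Proof.
move=> xy yz; have := @unit_rel1 x y z (U y z) xy.
by rewrite fi_unit_entry// !mul1r !mul0r !addr0.
Qed.

Lemma t_add x y z : (x <= y)%O -> (y <= z)%O ->
  t x z = s x y * t y z + t x y * s y z.
Proof.
move=> xy yz; have := @unit_rel2 x y z (U y z) xy.
by rewrite fi_unit_entry// !mul1r !mul0r !addr0.
Qed.

(* The square of V y y is zero, so m vanishes on the diagonal, hence everywhere. *)
Lemma m_eq0 x y : m x y = 0.
Proof.
have [xy|xy] := boolP (x <= y)%O; last by rewrite incidence_out.
have VV : V y y * V y y = 0.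
  by apply: D_ext; rewrite ?DM1 ?DM2 ?mul0r//= iconv_zerol iconv_zeror addr0.
have myy : m y y = 0.
  have /(congr1 (fun b : Dalg X K => b.1 y y)) := phiM (V y y) (V y y).
  rewrite VV D1_diag linear_map0// => /esym/eqP; rewrite mulf_eq0 orbb.
  by move/eqP.
have := @unit_rel1 x y y (V y y) xy.
by rewrite fi_unit_entry// !mul0r !add0r !mul1r => ->; rewrite myy mulr0.
Qed.

Lemma phi1 a x y : (phi a).1 x y = s x y * a.1 x y.
Proof. by rewrite phi_entry1 m_eq0 mulr0 addr0 mulrC. Qed.

Lemma n_right x y : (x <= y)%O -> n x y = s x y * n y y.
Proof.
move=> xy; have := @unit_rel2 x y y (V y y) xy.
by rewrite m_eq0 fi_unit_entry// !mul0r !mul1r !add0r mulr0 addr0.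
Qed.

Lemma n_left x y : (x <= y)%O -> n x y = n x x * s x y.
Proof.
move=> xy; have /(congr1 (fun b : Dalg X K => b.2 x y)) := phiM (V x x) (U x y).
rewrite phi_entry2 DM1 mul0r mul0r add0r !DM2 iconv_zerol add0r.
rewrite iconv_unitl// fi_unit_entry// mul1r => ->.
have -> : (phi (V x x)).1 = 0.
  by apply: finitary_ext => u v; rewrite phi1 mulr0.
rewrite iconv_zerol add0r (@iconv_single _ _ _ _ _ _ x)// => w.
rewrite phi_entry2 mul0r add0r mulf_eq0 negb_or => /andP[+ _] _.
by move=> /(fi_unit_neq0 (lexx x))[].
Qed.

Lemma s_neq0 x y : (x <= y)%O -> s x y != 0.
Proof.
move=> xy; have [a /(congr1 (fun b : Dalg X K => b.1 x y))] := phi_surj (U x y).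
rewrite phi1 fi_unit_entry// => e; apply/eqP => s0.
by move: e; rewrite s0 mul0r => /esym/eqP; rewrite oner_eq0.
Qed.

Lemma n_diag_neq0 x : n x x != 0.
Proof.
have [a e] := phi_surj (V x x).
have /(congr1 (fun b : Dalg X K => b.1 x x)) := e.
have /(congr1 (fun b : Dalg X K => b.2 x x)) := e.
rewrite phi1 phi_entry2 fi_unit_entry// => e2 /eqP.
rewrite mulf_eq0 (negbTE (s_neq0 (lexx x))) orFb => /eqP a0.
apply/eqP => n0; move: e2; rewrite a0 n0 mul0r mulr0 addr0.
by move=> /esym/eqP; rewrite oner_eq0.
Qed.

Hypothesis connected : poset_connected X.

(** By [n_left] and [n_right], the diagonal of [n] is constant along comparable
    pairs. *)
Lemma n_const : exists2 k : K, k != 0 & forall x y, n x y = k * s x y.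
Proof.
have step x y : (x >=< y)%O -> n x x = n y y.
  wlog xy : x y / (x <= y)%O => [h /orP[xy|yx]|_].
  - by apply: h => //; rewrite /Order.comparable xy.
  - by apply/esym/h => //; rewrite /Order.comparable yx.
  apply: (mulIf (s_neq0 xy)); rewrite -n_left// n_right// mulrC.
  by [].
have [[x0 _]|noX] := pselect (exists x : X, True); last first.
  by exists 1; [exact: oner_neq0|move=> x; case: noX; exists x].
exists (n x0 x0); first exact: n_diag_neq0.
have const y : n x0 x0 = n y y.
  have [p] := connected x0 y; elim: p x0 => [x0 _ <- //|z p IH x0 /andP[/step -> ]].
  exact: IH.
move=> x y; have [xy|xy] := boolP (x <= y)%O; last first.
  by rewrite [LHS]incidence_out// [s x y]incidence_out// mulr0.
by rewrite n_left// (const x).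
Qed.

Hypothesis der_inner : forall D : finitary X K -> incidence X K,
  fi_derivation D -> fi_inner_derivation D.
Hypothesis mult_inner : forall s : incidence X K,
  mult_cocycle s -> inner_automorphism (mult_map s).

(** [phi] multiplies the entries of [f] and [i] by [s] and [k s], up to the
    derivation given by the additive cocycle [t / s]; both are inner. *)
Lemma fixing_idem_normal_form : exists (u v : Dalg X K) (k : K),
  [/\ u * v = 1, v * u = 1, k != 0 & forall a, phi a = u * kdelta_tilde k a * v].
Proof.
have sC : mult_cocycle s by split; [exact: s_neq0|exact: s_mul].
have [f [g [fg gf sE]]] := mult_inner_hadamard sC (mult_inner sC).
have [k k0 nE] := n_const.
have qin : (fun x y => t x y / s x y) \in incidence_pred X K.
  by apply/asboolP => x y xy; rewrite incidence_out// mul0r.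
pose q := Incidence qin.
have qA x y z : (x <= y)%O -> (y <= z)%O -> q x z = q x y + q y z.
  have qE u v : q u v = t u v / s u v by [].
  move=> xy yz; rewrite !qE (t_add xy yz) -(s_mul xy yz).
  by field; rewrite !s_neq0.
have [j jE] := der_inner (add_cocycle_derivation qA).
(* Conjugation by (1, - j) realizes the derivation given by q. *)
pose w (i : incidence X K) : Dalg X K := (1, i).
have ww i : w i * w (- i) = 1.
  by apply: D_ext; rewrite ?DM1 ?DM2 ?mul1r//= iconv1l iconv1r addNr.
have w'w : w (- j) * w j = 1 by rewrite -[X in _ * w X]opprK ww.
exists (Dfi f * w (- j)), (w j * Dfi g), k.
split=> //.
- by rewrite mulrA -(mulrA (Dfi f)) w'w mulr1 DfiM fg.
- by rewrite mulrA -(mulrA (w j)) DfiM gf mulr1 ww.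
move=> a; rewrite mulrA -(mulrA (Dfi f)) -(mulrA (Dfi f)).
have -> : w (- j) * kdelta_tilde k a * w j =
    ((a.1, k *: a.2 + hadamard q a.1) : Dalg X K).
  apply: D_ext; first by rewrite !DM1 mul1r mulr1.
  rewrite !DM2 DM1 mul1r !iconv1l iconv1r iconvNl [hadamard _ _]jE.
  by rewrite [RHS]addrCA.
apply: D_ext.
  apply: finitary_ext => x y; rewrite phi1.
  exact: (congr1 (fun i : incidence X K => i x y) (sE a.1)).
apply: incidence_ext => x y; rewrite !DM2 !iconv_zerol !iconv_zeror addr0 add0r.
rewrite -sE phi_entry2 nE.
rewrite -[RHS]/(s x y * (k * a.2 x y + (t x y / s x y) * a.1 x y)).
have [xy|xy] := boolP (x <= y)%O; last first.
  by rewrite [a.1 x y]incidence_out// [a.2 x y]incidence_out//; ring.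
by field; exact: s_neq0.
Qed.

End NormalForm.

(** * The anti-automorphism of the poset induced by an anti-automorphism *)

Section Induced.
Context {d : Order.disp_t} {X : porderType d} {K : fieldType}.
Implicit Types (i j : incidence X K) (f g : finitary X K) (a b : Dalg X K).
Implicit Types (x y z : X).

Lemma Didem_conj_inj x y : ring_conjugate (Didem x : Dalg X K) (Didem y) -> x = y.
Proof.
move=> /(@conj_diag _ _ _ _ _ x) /=; rewrite !eqxx andbb.
by case: eqVneq => // _ /eqP; rewrite oner_eq0.
Qed.

(** The corner ring at [x] has no nontrivial idempotents. *)
Lemma corner_idem x a : a * a = a -> Didem x * a = a -> a * Didem x = a ->
  a = 0 \/ a = Didem x.
Proof.
move=> aa xa ax; have := D_sandwich a x x; rewrite xa ax.
have /(congr1 (fun a : Dalg X K => a.1 x x)) := aa; rewrite D1_diag.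
have /(congr1 (fun a : Dalg X K => a.2 x x)) := aa.
rewrite DM2 incidenceD !iconv_diag fi_unitxx.
move: (a.1 x x) (a.2 x x) => k l e2 e1 ->.
have [k0|k0] := eqVneq k 0.
  by left; move: e2; rewrite k0 mul0r mulr0 addr0 => <-; rewrite !scale0r addr0.
have {}e1 : k = 1 by apply: (mulfI k0); rewrite mulr1.
right; move: e2; rewrite e1 mul1r mulr1 => /eqP.
by rewrite -subr_eq0 addrK => /eqP ->; rewrite scale1r scale0r addr0.
Qed.

Lemma D_anti1 (Phi : Dalg X K -> Dalg X K) : D_anti_automorphism Phi -> Phi 1 = 1.
Proof.
by move=> [_ [Psi PhiK PsiK] PhiM]; rewrite -[LHS]mul1r -{1}[1]PsiK -PhiM mul1r PsiK.
Qed.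

Lemma D_anti_inv (Phi Psi : Dalg X K -> Dalg X K) :
  D_anti_automorphism Phi -> cancel Phi Psi -> cancel Psi Phi ->
  D_anti_automorphism Psi.
Proof.
move=> [PhiL _ PhiM] PhiK PsiK; split; last 1 first.
- by move=> a b; apply: (can_inj PhiK); rewrite PhiM !PsiK.
- by move=> k a b; apply: (can_inj PhiK); rewrite PhiL !PsiK.
- by exists Phi.
Qed.

Lemma D_anti_conj (Phi : Dalg X K -> Dalg X K) a b : D_anti_automorphism Phi ->
  ring_conjugate a b -> ring_conjugate (Phi a) (Phi b).
Proof.
move=> PhiA [u [v [uv vu ->]]]; have [_ _ PhiM] := PhiA.
exists (Phi v), (Phi u); split; rewrite -?PhiM ?uv ?vu ?D_anti1//.
by rewrite !PhiM mulrA.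
Qed.

(** The image of [Didem x] is conjugate to the idempotent of a set of points,
    which is a singleton because [Didem x] is primitive. *)
Lemma anti_idem_conj (Phi : Dalg X K -> Dalg X K) x : D_anti_automorphism Phi ->
  exists p, ring_conjugate (Phi (Didem x)) (Didem p).
Proof.
move=> PhiA; have [PhiL [Psi PhiK PsiK] PhiM] := PhiA.
pose P := Phi (Didem x).
have PP : P * P = P by rewrite /P -PhiM Didem_idem.
have := D_idem_conj_diag PP; set e := Dfi _ => Pe.
have [u [v [uv vu eE]]] := Pe.
have PE : P = v * e * u by rewrite eE !mulrA vu mul1r -mulrA vu mulr1.
have Phi0 : Phi 0 = 0 by exact: linear_map0.
have Phi_eq0 a : Phi a = 0 -> a = 0.
  by move=> Pa; apply: (can_inj PhiK); rewrite Pa Phi0.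
have [p Pp] : exists p, P.1 p p != 0.
  apply: contrapT => np; have /eqP[] := Didem_neq0 (K := K) x.
  apply: Phi_eq0; rewrite -/P PE (_ : e = 0) ?mulr0 ?mul0r//.
  apply: D_eq => s t //=; rewrite (_ : P.1 s s = 0) ?mulr0//.
  by apply/eqP; apply: contrapT => /negP Ps; apply: np; exists s.
have Pp1 : P.1 p p = 1.
  by apply: (mulfI Pp); rewrite mulr1 -D1_diag PP.
exists p.
have pe : Didem p * e = Didem p.
  rewrite /Didem fi_idemE DfiM fi_diagM; congr (Dfi (fi_diag _)); apply/funext => s.
  by case: eqVneq => [->|_]; rewrite ?Pp1 ?mulr1// mul0r.
have ep : e * Didem p = Didem p.
  rewrite /Didem fi_idemE DfiM fi_diagM; congr (Dfi (fi_diag _)); apply/funext => s.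
  by case: eqVneq => [->|_]; rewrite ?Pp1 ?mulr1// mulr0.
pose E := v * Didem p * u.
have sw a b : (v * a * u) * (v * b * u) = v * (a * b) * u.
  by rewrite -!mulrA (mulrA u v) uv mul1r.
have EE : E * E = E by rewrite /E sw Didem_idem.
have EP : E * P = E by rewrite PE sw pe.
have PE' : P * E = E by rewrite PE sw ep.
have [||| |] := @corner_idem x (Psi E).
- by apply: (can_inj PhiK); rewrite PhiM PsiK.
- by apply: (can_inj PhiK); rewrite PhiM PsiK.
- by apply: (can_inj PhiK); rewrite PhiM PsiK.
- move=> /(congr1 Phi); rewrite PsiK Phi0 => E0.
  have /eqP[] := Didem_neq0 (K := K) p.
  have -> : Didem p = u * E * v :> Dalg X K.
    by rewrite /E !mulrA uv mul1r -mulrA uv mulr1.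
  by rewrite E0 mulr0 mul0r.
move=> /(congr1 Phi); rewrite PsiK -/P => EqP.
exists u, v; split=> //; rewrite -/P -EqP.
by rewrite /E !mulrA uv mul1r -mulrA uv mulr1.
Qed.

(** [x <= y] means that the corner [e_x D e_y] is nonzero; an anti-automorphism
    exchanges the two sides. *)
Lemma anti_induced_le (Phi : Dalg X K -> Dalg X K) (l : X -> X) x y :
  D_anti_automorphism Phi -> (forall x, ring_conjugate (Phi (Didem x)) (Didem (l x))) ->
  (x <= y)%O -> (l y <= l x)%O.
Proof.
move=> PhiA hl xy; have [PhiL /bij_inj PhiI PhiM] := PhiA.
apply: contrapT => /negP nle.
have Phi0 : Phi 0 = 0 by exact: linear_map0.
have [u [v [_ vu ex]]] := ring_conjugate_sym (hl x).
have [w [t [_ tw ey]]] := ring_conjugate_sym (hl y).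
have U0 : Dfi (fi_unit x y) = 0 :> Dalg X K.
  apply: PhiI; rewrite Phi0.
  have -> : Dfi (fi_unit x y) = Didem x * (Dfi (fi_unit x y) * Didem y) :> Dalg X K.
    by rewrite mulrA D_sandwich fi_unit_entry// scale1r scale0r addr0.
  rewrite !PhiM ex ey.
  have -> a : w * Didem (l y) * t * a * (u * Didem (l x) * v) =
      w * (Didem (l y) * (t * a * u) * Didem (l x)) * v by rewrite !mulrA.
  rewrite D_sandwich [X in X *: _ + _]incidence_out//.
  by rewrite [X in _ + X *: _]incidence_out// !scale0r addr0 mulr0 mul0r.
have /(congr1 (fun a : Dalg X K => a.1 x y)) := U0.
by rewrite fi_unit_entry// => /eqP; rewrite oner_eq0.
Qed.

Lemma anti_induced (Phi : Dalg X K -> Dalg X K) : D_anti_automorphism Phi ->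
  exists l : poset_antiaut X, induced_by Phi l.
Proof.
move=> PhiA; have [PhiL [Psi PhiK PsiK] PhiM] := PhiA.
have PsiA := D_anti_inv PhiA PhiK PsiK.
have /choice[l hl] := fun x => anti_idem_conj x PhiA.
have /choice[l' hl'] := fun x => anti_idem_conj x PsiA.
have l'K : cancel l' l.
  move=> y; apply: Didem_conj_inj; apply: ring_conjugate_sym.
  apply: ring_conjugate_trans (hl (l' y)).
  by rewrite -{1}[Didem y]PsiK; apply: D_anti_conj.
have lK : cancel l l'.
  move=> x; apply: Didem_conj_inj; apply: ring_conjugate_sym.
  apply: ring_conjugate_trans (hl' (l x)).
  by rewrite -{1}[Didem x]PhiK; apply: D_anti_conj.
have anti x y : (x <= y)%O = (l y <= l x)%O.
  apply/idP/idP; first exact: anti_induced_le PhiA hl.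
  by rewrite -{2}[x]lK -{2}[y]lK; exact: anti_induced_le PsiA hl'.
by exists (PosetAntiaut lK l'K anti).
Qed.

End Induced.

(** * Decomposition of anti-automorphisms and involutions *)

Section Decomposition.
Context {d : Order.disp_t} {X : porderType d} {K : fieldType}.
Implicit Types (i j : incidence X K) (f g : finitary X K) (a b : Dalg X K).
Implicit Types (x y z : X) (l : poset_antiaut X).

Lemma rho_inc_iconv l i j :
  rho_inc l (iconv i j) = iconv (rho_inc l j) (rho_inc l i).
Proof.
apply: incidence_ext => x y.
rewrite -[LHS]/(iconv_fun i j (pa_inv l y) (pa_inv l x)).
rewrite -[RHS]/(iconv_fun (rho_inc l j) (rho_inc l i) x y) /iconv_fun.
rewrite (reindex_fsbig (pa_inv l) [set z : X | (x <= z <= y)%O]%classic).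
  by apply: eq_fsbigr => z _; rewrite mulrC.
split.
- by move=> z /= /andP[xz zy]; rewrite -!pa_inv_anti zy xz.
- by move=> z w _ _ /(can_inj (pa_invK l)).
- move=> z /= /andP[xz zy]; exists (l z); last exact: pa_funK.
  by rewrite /= !(pa_inv_anti l _ (l z)) !(pa_inv_anti l (l z)) pa_funK zy xz.
Qed.

Lemma rho_tildeM l a b : rho_tilde l (a * b) = rho_tilde l b * rho_tilde l a.
Proof.
apply: D_ext; first by apply/val_inj; exact: rho_inc_iconv.
have D (i j : incidence X K) : rho_inc l (i + j) = rho_inc l i + rho_inc l j.
  exact: incidence_ext.
by rewrite DM2 -!rho_inc_iconv addrC -D.
Qed.

Lemma rho_tilde_linear l : linear (@rho_tilde d X K l).
Proof. by move=> k a b; apply: D_eq. Qed.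

(** The inverse of an anti-automorphism of the poset. *)
Definition antiaut_inv l : poset_antiaut X :=
  PosetAntiaut (pa_invK l) (pa_funK l) (pa_inv_anti l).

Lemma rho_tildeK l : cancel (@rho_tilde d X K l) (rho_tilde (antiaut_inv l)).
Proof. by move=> a; apply: D_eq => x y /=; rewrite !pa_funK. Qed.

Lemma rho_tilde_idem l x : rho_tilde l (Didem x) = Didem (l x) :> Dalg X K.
Proof.
apply: D_eq => // u v /=.
by rewrite andbC !(can2_eq (pa_invK l) (pa_funK l)).
Qed.

(** Composing with the inverse of [rho_tilde] reduces the decomposition to the
    automorphisms that fix every idempotent [Didem x] up to conjugation. *)
Lemma anti_automorphism_decomp (Phi : Dalg X K -> Dalg X K) l :
  poset_connected X ->
  (forall D : finitary X K -> incidence X K,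
     fi_derivation D -> fi_inner_derivation D) ->
  (forall s : incidence X K, mult_cocycle s -> inner_automorphism (mult_map s)) ->
  D_anti_automorphism Phi -> induced_by Phi l ->
  exists (Psi : Dalg X K -> Dalg X K) (k : K),
    [/\ inner_automorphism Psi, k != 0 &
        forall a, Phi a = Psi (rho_tilde l (kdelta_tilde k a))].
Proof.
move=> conn der mul [PhiL [Phi' PhiK Phi'K] PhiM] hl.
pose phi a := Phi (rho_tilde (antiaut_inv l) a).
have phiL : linear phi by move=> k a b; rewrite /phi rho_tilde_linear PhiL.
have phiM a b : phi (a * b) = phi a * phi b by rewrite /phi rho_tildeM PhiM.
have phi_conj x : ring_conjugate (phi (Didem x)) (Didem x).
  rewrite /phi rho_tilde_idem -{2}[x](pa_invK l); exact: hl.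
have [u [v [uv vu e]]] := simultaneous_conj phiM (linear_map0 phiL) phi_conj.
pose psi a := v * phi a * u.
have psiL : linear psi.
  by move=> k a b; rewrite /psi phiL mulrDr mulrDl -D_scalerAr -D_scalerAl.
have psiM a b : psi (a * b) = psi a * psi b.
  by rewrite /psi phiM !mulrA -(mulrA _ u v) uv mulr1.
have psi_surj b : exists a, psi a = b.
  exists (rho_tilde l (Phi' (u * b * v))).
  by rewrite /psi /phi rho_tildeK Phi'K !mulrA vu mul1r -mulrA vu mulr1.
have psi_idem x : psi (Didem x) = Didem x.
  by rewrite /psi e !mulrA vu mul1r -mulrA vu mulr1.
have [w [t [k [wt tw k0 psiE]]]] :=
  fixing_idem_normal_form psiL psiM psi_surj psi_idem conn der mul.
exists (fun a => u * w * a * (t * v)), k; split=> //.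
  exists (u * w), (t * v); split=> //.
    by rewrite mulrA -(mulrA u) wt mulr1.
  by rewrite mulrA -(mulrA t) vu mulr1.
move=> a; rewrite -[a in LHS](rho_tildeK l) -/(phi _).
have -> : phi (rho_tilde l a) = u * psi (rho_tilde l a) * v.
  by rewrite /psi !mulrA uv mul1r -mulrA uv mulr1.
by rewrite psiE !mulrA.
Qed.

(** Inner automorphisms preserve the diagonal entries of the elements of the
    ideal [I(X,K)], so that the square of [Phi] multiplies these by [k * k], up to
    a permutation of the diagonal that does not affect [delta_inc]. *)
Lemma involution_scalar (Phi Psi : Dalg X K -> Dalg X K) l (k : K) x :
  involutive Phi -> inner_automorphism Psi ->
  (forall a, Phi a = Psi (rho_tilde l (kdelta_tilde k a))) -> k * k = 1.
Proof.
move=> PhiK [u [v [uv _ PsiE]]] PhiE.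
have Phi1 a : a.1 = 0 -> (Phi a).1 = 0.
  move=> a0; rewrite PhiE PsiE !DM1 (_ : (rho_tilde _ _).1 = 0) ?mulr0 ?mul0r//.
  by apply: finitary_ext => s t /=; rewrite a0.
have Phi2 a y : a.1 = 0 ->
    (Phi a).2 y y = k * a.2 (pa_inv l y) (pa_inv l y).
  move=> a0; rewrite PhiE PsiE !DM2 DM1.
  rewrite (_ : (rho_tilde _ _).1 = 0); last first.
    by apply: finitary_ext => s t /=; rewrite a0.
  rewrite mulr0 iconv_zerol add0r iconv_zeror addr0 !iconv_diag mulrAC -D1_diag uv.
  by rewrite /= eqxx mul1r.
have := PhiK (Dinc delta_inc); move/(congr1 (fun a : Dalg X K => a.2 x x)).
rewrite Phi2; last exact: Phi1.
by rewrite Phi2//= !eqxx mulr1.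
Qed.

Lemma involution_induced (Phi : Dalg X K -> Dalg X K) l :
  D_involution Phi -> induced_by Phi l -> poset_involution l.
Proof.
move=> [PhiA PhiK] hl x; apply: (@Didem_conj_inj _ _ K); apply: ring_conjugate_sym.
apply: ring_conjugate_trans (hl (l x)).
by rewrite -{1}[Didem x]PhiK; exact: D_anti_conj PhiA (hl x).
Qed.

End Decomposition.

(** * Posets with an element comparable with all elements *)

Section Comparable.
Context {d : Order.disp_t} {X : porderType d} {K : fieldType}.
Implicit Types (s t i : incidence X K) (f g : finitary X K).
Implicit Types (x y z : X).

Variable x0 : X.
Hypothesis x0_comp : forall y, (x0 >=< y)%O.

Lemma comparable_connected : poset_connected X.
Proof.
by move=> x y; exists [:: x0; y] => //=; rewrite comparable_sym !x0_comp.
Qed.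

Lemma mult_cocycle_inner s : mult_cocycle s -> inner_automorphism (mult_map s).
Proof.
move=> sC; have [s0 sM] := sC; have s1 := fun x => mult_cocycle_diag x sC.
(* [s] is the coboundary of its values along [x0]. *)
pose h x := if (x0 <= x)%O then s x0 x else (s x x0)^-1.
have xx0 x : ~~ (x0 <= x)%O -> (x <= x0)%O.
  by have := x0_comp x; rewrite /Order.comparable => /orP[->|].
have h0 x : h x != 0.
  by rewrite /h; case: ifPn => [/s0//|/xx0/s0]; rewrite invr_eq0.
exists (fi_diag (fun x => (h x)^-1)), (fi_diag h); split.
- by rewrite fi_diagM -fi_diag1; congr fi_diag; apply/funext => x; rewrite mulVf.
- by rewrite fi_diagM -fi_diag1; congr fi_diag; apply/funext => x; rewrite divff.
move=> f; apply: finitary_ext => x y.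
rewrite !finitaryME iconv_diagr iconv_diagl -[LHS]/(s x y * f x y).
have [xy|xy] := boolP (x <= y)%O; last by rewrite [f x y]incidence_out// !mulr0 mul0r.
suff -> : s x y = (h x)^-1 * h y by rewrite mulrAC.
apply: (mulfI (h0 x)); rewrite mulrA divff// mul1r /h.
case: ifPn => x0x; first by rewrite (le_trans x0x xy) sM.
apply: (mulfI (s0 _ _ (xx0 _ x0x))); rewrite mulrA divff ?s0 ?xx0// mul1r.
case: ifPn => x0y; first by rewrite sM// xx0.
by rewrite -(sM x y x0)// ?mulfK ?s0 ?xx0.
Qed.

Lemma commutator_derivation j :
  fi_derivation (fun f => iconv j f - iconv f j).
Proof.
split=> [c f g|f g].
  rewrite iconvDfr iconvDfl -!/(_ *: _) iconvZl iconvZr scalerBr.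
  by rewrite opprD addrACA.
rewrite iconvDr iconvDl iconvNl iconvNr iconvA_iff iconvA_ffi iconvA_fif.
by rewrite addrA subrK.
Qed.

Lemma derivation_sub (D E : finitary X K -> incidence X K) :
  fi_derivation D -> fi_derivation E -> fi_derivation (fun f => D f - E f).
Proof.
move=> [DL DM] [EL EM]; split=> [c f g|f g].
  by rewrite DL EL scalerBr opprD addrACA.
by rewrite DM EM iconvDr iconvDl iconvNl iconvNr opprD addrACA.
Qed.

(** Every derivation agrees with an inner one on the diagonal idempotents. *)
Lemma derivation_idem (D : finitary X K -> incidence X K) : fi_derivation D ->
  exists j, forall x, D (fi_idem x) = iconv j (fi_idem x) - iconv (fi_idem x) j.
Proof.
move=> [DL DM].
have jin : (fun a b => D (fi_idem b) a b) \in incidence_pred X K.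
  by apply/asboolP => x y xy; rewrite incidence_out.
(* Column x of j is that of D e_x. *)
exists (Incidence jin) => x; apply: incidence_ext => a b.
rewrite incidenceD incidenceN iconv_ideml iconv_idemr /=.
have DE y z : D (fi_idem y * fi_idem z) a b =
    D (fi_idem y) a b * (b == z)%:R + (a == y)%:R * D (fi_idem z) a b.
  by rewrite DM incidenceD iconv_ideml iconv_idemr.
have [bx|bx] := eqVneq b x.
  subst b; rewrite mulr1; case: eqVneq => [ax|_]; last by rewrite mul0r subr0.
  subst a; rewrite mul1r subrr.
  have := DE x x; rewrite fi_idemE fi_diagM.
  rewrite [fi_diag (fun x => _)](_ : _ = fi_idem x); last first.
    by rewrite fi_idemE; congr fi_diag; apply/funext => u; rewrite -natrM mulnb andbb.
  rewrite -fi_idemE eqxx mulr1 mul1r => /eqP.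
  by rewrite -subr_eq0 opprD addNKr oppr_eq0 => /eqP.
have := DE x b; rewrite eqxx mulr1 => DE'.
rewrite mulr0 sub0r; apply/eqP; rewrite -addr_eq0 -DE'.
rewrite (_ : fi_idem x * fi_idem b = 0) ?linear_map0//.
apply: finitary_ext => u v; rewrite finitaryME iconv_ideml /=.
case: (eqVneq u x) => [->|]; rewrite ?mul0r// mul1r.
by rewrite eq_sym (negbTE bx).
Qed.

Lemma idem_fi_sandwich f x y :
  fi_idem x * f * fi_idem y = f x y *: fi_unit x y.
Proof.
have /(congr1 fst) := D_sandwich (Dfi f) x y.
by rewrite scale0r addr0.
Qed.

(** A derivation killing the diagonal idempotents multiplies entries by an
    additive cocycle. *)
Lemma derivation_cocycle (D : finitary X K -> incidence X K) :
  fi_derivation D -> (forall x, D (fi_idem x) = 0) ->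
  exists2 t : incidence X K,
    (forall x y z, (x <= y)%O -> (y <= z)%O -> t x z = t x y + t y z) &
    (forall f, D f = hadamard t f).
Proof.
move=> [DL DM] D0.
have tin : (fun x y => D (fi_unit x y) x y) \in incidence_pred X K.
  by apply/asboolP => x y xy; rewrite incidence_out.
pose t := Incidence tin.
have DZ c f : D (c *: f) = c *: D f.
  by have := DL c f 0; rewrite !addr0 (linear_map0 DL) addr0.
have DE f x y : D f x y = t x y * f x y.
  have : D (fi_idem x * f * fi_idem y) = iconv (iconv (fi_idem x) (D f)) (fi_idem y).
    by rewrite !DM !D0 iconv_zerol iconv_zeror addr0 add0r.
  rewrite idem_fi_sandwich DZ => /(congr1 (fun i : incidence X K => i x y)).
  by rewrite iconv_idemr iconv_ideml !eqxx mulr1 mul1r incidenceZ mulrC.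
exists t; last by move=> f; apply: incidence_ext => x y; rewrite DE.
move=> x y z xy yz.
have /(congr1 (fun i : incidence X K => i x z)) := DM (fi_unit x y) (fi_unit y z).
rewrite DE finitaryME incidenceD !iconv_unitl// fi_unit_entry// mulr1 => ->.
rewrite DE fi_unit_entry// mulr1; congr (_ + _).
rewrite (@iconv_single _ _ _ _ _ _ y) ?DE ?fi_unit_entry ?mulr1// => w.
by rewrite DE mulf_eq0 negb_or => /andP[_ /(fi_unit_neq0 xy)[]].
Qed.

Lemma derivation_inner (D : finitary X K -> incidence X K) :
  fi_derivation D -> fi_inner_derivation D.
Proof.
move=> Dder; have [j jE] := derivation_idem Dder.
have [||t tA tE] := @derivation_cocycle (fun f => D f - (iconv j f - iconv f j)).
- exact: derivation_sub Dder (commutator_derivation j).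
- by move=> x; rewrite jE subrr.
(* [t] is the coboundary of its values along [x0]. *)
pose h x := if (x0 <= x)%O then t x0 x else - t x x0.
have xx0 x : ~~ (x0 <= x)%O -> (x <= x0)%O.
  by have := x0_comp x; rewrite /Order.comparable => /orP[->|].
have th x y : (x <= y)%O -> t x y = h y - h x.
  move=> xy; rewrite /h; case: (ifPn (x0 <= x)%O) => x0x.
    by rewrite (le_trans x0x xy) (tA x0 x y)// addrC addKr.
  have := xx0 _ x0x => {}x0x; rewrite opprK; case: ifPn => x0y.
    by rewrite (tA x x0 y)// addrC.
  by rewrite (tA x y x0) ?xx0// addrC addrK.
exists ((fi_diag h : incidence X K) - j) => f.
rewrite iconvDl iconvDr iconvNl iconvNr.
have -> : D f = hadamard t f + (iconv j f - iconv f j) by rewrite -tE subrK.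
have -> : hadamard t f = iconv f (fi_diag h) - iconv (fi_diag h) f.
  apply: incidence_ext => x y; rewrite incidenceD incidenceN iconv_diagl iconv_diagr.
  rewrite -[LHS]/(t x y * f x y).
  have [xy|xy] := boolP (x <= y)%O; last by rewrite [f x y]incidence_out//; ring.
  by rewrite th//; ring.
by rewrite opprB [RHS]addrACA [LHS]addrACA; congr (_ + _); rewrite addrC.
Qed.

End Comparable.

Theorem corollary5p4 (d : Order.disp_t) (X : porderType d) (K : fieldType) :
  (poset_connected X ->
   (forall D : finitary X K -> incidence X K,
      fi_derivation D -> fi_inner_derivation D) ->
   (forall s : incidence X K,
      mult_cocycle s -> inner_automorphism (mult_map s)) ->
   forall Phi : Dalg X K -> Dalg X K,
     (D_anti_automorphism Phi ->
      exists l : poset_antiaut X, induced_by Phi l /\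
      exists (Psi : Dalg X K -> Dalg X K) (k : K),
        [/\ inner_automorphism Psi, k != 0 &
            forall a, Phi a = Psi (rho_tilde l (kdelta_tilde k a))]) /\
     (D_involution Phi ->
      exists l : poset_antiaut X, induced_by Phi l /\ poset_involution l /\
      exists (Psi : Dalg X K -> Dalg X K) (k : K),
        [/\ inner_automorphism Psi, k != 0,
            (forall a, Phi a = Psi (rho_tilde l (kdelta_tilde k a))) &
            k = 1 \/ k = -1])) /\
  ((exists x0 : X, forall y : X, (x0 >=< y)%O) ->
   [/\ poset_connected X,
       (forall D : finitary X K -> incidence X K,
          fi_derivation D -> fi_inner_derivation D) &
       (forall s : incidence X K,
          mult_cocycle s -> inner_automorphism (mult_map s))]).
Proof.
split=> [conn der mul Phi|[x0 x0_comp]]; last first.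
  split; first exact: comparable_connected x0_comp.
    exact: derivation_inner x0_comp.
  exact: mult_cocycle_inner x0_comp.
split=> [PhiA|PhiI].
  have [l hl] := anti_induced PhiA.
  by exists l; split=> //; exact: anti_automorphism_decomp.
have [PhiA PhiK] := PhiI; have [l hl] := anti_induced PhiA.
exists l; split=> //; split; first exact: involution_induced PhiI hl.
have [Psi [k [PsiI k0 PhiE]]] := anti_automorphism_decomp conn der mul PhiA hl.
have [[x _]|noX] := pselect (exists x : X, True).
  exists Psi, k; split=> //.
  have /eqP := involution_scalar x PhiK PsiI PhiE.
  by rewrite -expr2 sqrf_eq1 => /orP[] /eqP ->; [left|right].
(* Over the empty poset the algebra is zero and any scalar will do. *)
exists Psi, 1; split=> //; [exact: oner_neq0| |by left].
move=> a; rewrite PhiE; congr (Psi (rho_tilde l _)).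
by apply: D_eq => x; case: noX; exists x.
Qed.
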